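(* Let $1\le p<\infty$, let $p'$ be the conjugate exponent ($\frac1p+\frac1{p'}=1$), and let $v,w$ be weights on $\mathbb{R}^n$. Let $X$ be a Banach function space on $\mathbb{R}^n$ (with Lebesgue measure) such that the weighted space $X_w$ is $p$-convex with $p$-convexity constant $M$. For measurable $f\ge 0$ put $H^*f(x)=\int_{|y|>|x|}f(y)\,dy$, $x\in\mathbb{R}^n$. For $\gamma\in(0,1)$ define $$B(\gamma)=\sup_{t>0}\left(\int_{|y|>t}[v(y)]^{-p'}\,dy\right)^{\frac{\gamma}{p'}}\left\|\chi_{\{|z|<t\}}(\cdot)\left(\int_{|y|>|\cdot|}[v(y)]^{-p'}\,dy\right)^{\frac{1-\gamma}{p'}}\right\|_{X_w}.$$ Then, for every $\gamma\in(0,1)$, there is a finite constant $C>0$ such that $$\|H^*f\|_{X_w}\le C\,\|f\|_{L_{p,v}}\quad\text{for every measurable } f\ge 0$$ if and only if $B(\gamma)<\infty$. Moreover, if $C>0$ is the best possible constant in this inequality, then $$\sup_{0<\gamma<1}\frac{p'\,B(\gamma)}{(1-\gamma)\left[\left(\frac{p'}{1-\gamma}\right)^{p}+\frac{1}{\gamma(p-1)}\right]^{1/p}}\le C\le M\inf_{0<\gamma<1}\frac{B(\gamma)}{(1-\gamma)^{1/p'}}.$$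
   Context: A weight on $\mathbb{R}^n$ is a positive, Lebesgue measurable, a.e. finite function. $\|f\|_{L_{p,v}}=\left(\int_{\mathbb{R}^n}|f(y)v(y)|^p\,dy\right)^{1/p}$. For $p=1$ one has $p'=\infty$, and the expressions are read with the usual conventions: $\left(\int_E v^{-p'}dy\right)^{1/p'}$ means $\operatorname{ess\,sup}_{E}v^{-1}$, and the numerical factors in the estimate of $C$ are read as their limits as $p\to1+$. A Banach function space (BFS) $X$ on a complete $\sigma$-finite measure space $(\Omega,\mu)$ is a real normed space of (classes of) real-valued $\mu$-measurable functions such that: (P1) $\|f\|_X\in[0,\infty]$ is defined for every measurable $f$, $f\in X$ iff $\|f\|_X<\infty$, and $\|f\|_X=0$ iff $f=0$ a.e.; (P2) $\|f\|_X=\||f|\|_X$; (P3) $0\le f\le g$ a.e. implies $\|f\|_X\le\|g\|_X$; (P4) $0\le f_n\uparrow f$ a.e. implies $\|f_n\|_X\uparrow\|f\|_X$ (Fatou property); (P5) $\mu(E)<\infty$ implies $\|\chi_E\|_X<\infty$; (P6) for every measurable $E$ with $\mu(E)<\infty$ there is $C_E>0$ with $\int_E f\,d\mu\le C_E\|f\|_X$ for every measurable $f\ge 0$. For a weight $w$, $X_w=\{f \text{ measurable}: fw\in X\}$ with norm $\|f\|_{X_w}=\|fw\|_X$. $X_w$ is $p$-convex ($1\le p<\infty$) with constant $M>0$ if for all $m\in\mathbb{N}$ and all $f_1,\dots,f_m\in X_w$, $\left\|\left(\sum_{k=1}^m|f_k|^p\right)^{1/p}\right\|_{X_w}\le M\left(\sum_{k=1}^m\|f_k\|_{X_w}^p\right)^{1/p}$.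 *)

(* Defs.v *)
From HB Require Import structures.
From mathcomp Require Import all_boot all_order all_algebra.
From mathcomp Require Import all_classical all_reals all_analysis.
From mathcomp Require Import measurable_realfun.

Set Implicit Arguments.
Unset Strict Implicit.
Unset Printing Implicit Defensive.

Import Order.TTheory GRing.Theory Num.Theory.
Import numFieldNormedType.Exports.

Local Open Scope classical_set_scope.
Local Open Scope ring_scope.
Local Open Scope ereal_scope.

(* Lebesgue measure on R^n, first on the sigma-algebra generated by the
   coordinates of n.-tuple, as an iterated integral of the Lebesgue measure on
   R; leb_borel_box computes it on boxes. *)
Section borel_lebesgue.
Context {R : realType}.

Fixpoint leb_borel (n : nat) : set (n.-tuple (measurableTypeR R)) -> \bar R :=
  match n return set (n.-tuple (measurableTypeR R)) -> \bar R with
  | 0 => \d_ [tuple]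
  | n'.+1 => fun A => \int[lebesgue_measure]_x
      @leb_borel n' [set t : n'.-tuple (measurableTypeR R) |
                       A [tuple of (x : measurableTypeR R) :: t]]
  end.

Let leb_borelP n :
  exists m : {sigma_finite_measure set (n.-tuple (measurableTypeR R)) -> \bar R},
    @leb_borel n = m.
Proof.
elim: n => [|n [m em]].
  by exists (\d_ [tuple]).
pose c (z : measurableTypeR R * n.-tuple (measurableTypeR R)) :=
  [tuple of z.1 :: z.2].
have mc : measurable_fun setT c.
  exact: (measurable_cons measurable_fst measurable_snd).
pose L : {sigma_finite_measure set (measurableTypeR R) -> \bar R} :=
  lebesgue_measure.
pose P (A : set (n.+1.-tuple (measurableTypeR R))) := (L \x m) (c @^-1` A).
have /sigma_finiteP[F [FT ndF Foo]] := sigma_finiteT L.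
have /sigma_finiteP[G [GT ndG Goo]] := sigma_finiteT m.
pose d (t : n.+1.-tuple (measurableTypeR R)) := (thead t, [tuple of behead t]).
have md : measurable_fun setT d.
  apply: measurable_fun_pair; last exact: measurable_behead.
  exact: measurable_tnth.
have cK : cancel d c by move=> t; rewrite /c/d/= -tuple_eta.
have dK : cancel c d.
  by move=> -[x t]; rewrite /d/c/= theadE; congr pair; apply: val_inj.
have mcA A : measurable A -> measurable (c @^-1` A).
  by move=> mA; rewrite -[X in measurable X]setTI; exact: mc.
have P0 : P set0 = 0 by rewrite /P preimage_set0 measure0.
have P_ge0 A : 0 <= P A by exact: measure_ge0.
have P_sig : semi_sigma_additive P.
  move=> B mB tB mUB; rewrite /P preimage_bigcup.
  apply: measure_semi_sigma_additive.
  - by move=> i; exact: mcA.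
  - apply/trivIsetP => /= i j _ _ ij; rewrite -preimage_setI.
    by move/trivIsetP : tB => /(_ _ _ _ _ ij) ->//; rewrite preimage_set0.
  - by rewrite -preimage_bigcup; exact: mcA.
pose P1 : {measure set _ -> \bar R} :=
  HB.pack_for (measure _ R) P (isMeasure.Build _ _ _ P P0 P_ge0 P_sig).
have P_fin : sigma_finite setT P1.
  exists (fun i => d @^-1` (F i `*` G i)).
    rewrite -preimage_bigcup; apply/esym; rewrite -subTset => t _.
    have [i _ Fi] : (\bigcup_i F i) (d t).1 by rewrite -FT.
    have [j _ Gj] : (\bigcup_i G i) (d t).2 by rewrite -GT.
    exists (maxn i j) => //; split.
    - by move: Fi; exact/subsetPset/ndF/leq_maxl.
    - by move: Gj; exact/subsetPset/ndG/leq_maxr.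
  move=> i; have [mF Foo'] := Foo i; have [mG Goo'] := Goo i; split.
    by rewrite -[X in measurable X]setTI; apply: md => //; exact: measurableX.
  rewrite /= /P -comp_preimage.
  rewrite (_ : d \o c = id); last exact/funext.
  by rewrite preimage_id product_measure1E// lte_mul_pinfty// ge0_fin_numE.
exists (HB.pack_for (sigma_finite_measure _ R) (Measure.sort P1)
  (Measure_isSigmaFinite.Build _ _ _ P1 P_fin)).
apply/funext => A /=; rewrite /P em /= /product_measure1.
by apply: eq_integral => x _ /=; congr (m _); rewrite xsectionE.
Qed.

Let leb_borel_measure0 n : @leb_borel n set0 = 0.
Proof. by have [m ->] := leb_borelP n; exact: measure0. Qed.

Let leb_borel_ge0 n A : 0 <= @leb_borel n A.
Proof. by have [m ->] := leb_borelP n; exact: measure_ge0. Qed.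

Let leb_borel_sigma_additive n : semi_sigma_additive (@leb_borel n).
Proof. by have [m ->] := leb_borelP n; exact: measure_semi_sigma_additive. Qed.

HB.instance Definition _ n := isMeasure.Build _ _ _ (@leb_borel n)
  (leb_borel_measure0 n) (@leb_borel_ge0 n) (@leb_borel_sigma_additive n).

Let leb_borel_sigma_finite n : sigma_finite setT (@leb_borel n).
Proof. by have [m ->] := leb_borelP n; exact: sigma_finiteT. Qed.

HB.instance Definition _ n := Measure_isSigmaFinite.Build _ _ _ (@leb_borel n)
  (@leb_borel_sigma_finite n).

Lemma leb_borel_box n (A : 'I_n -> set (measurableTypeR R)) :
  (forall i, measurable (A i)) ->
  @leb_borel n [set x | forall i, A i (tnth x i)] =
  \prod_(i < n) lebesgue_measure (A i).
Proof.
elim: n A => [|n IH] A mA.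
  by rewrite big_ord0 /= diracE mem_set// => -[].
rewrite big_ord_recl -IH; last by move=> i; exact: mA.
set B := [set t : n.-tuple (measurableTypeR R) |
  forall i, A (lift ord0 i) (tnth t i)].
transitivity (\int[@lebesgue_measure R]_x
    (@leb_borel n B * (\1_(A ord0) x)%:E)); last first.
  rewrite ge0_integralZl//.
  - by rewrite integral_indic// setIT muleC.
  - by apply/measurable_EFinP; exact: measurable_indic.
apply: eq_integral => x _ /=.
rewrite indicE; have [xA|xA] := boolP (x \in A ord0).
  rewrite mule1; congr leb_borel; apply/seteqP; split => t /= H i.
    by have := H (lift ord0 i); rewrite tnthS.
  have [j ->|->] := unliftP ord0 i; first by rewrite tnthS; exact: H.
  exact: set_mem xA.
rewrite mule0 (_ : mkset _ = set0) ?measure0//.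
apply/seteqP; split => t //= /(_ ord0); rewrite tnth0 => /mem_set.
by rewrite (negbTE xA).
Qed.

End borel_lebesgue.

(* R^n with the sigma-algebra of Lebesgue measurable sets, that is, the
   Caratheodory measurable sets for the outer measure induced by leb_borel. *)
Definition Rn (R : realType) (n : nat) :=
  caratheodory_type ((@leb_borel R n)^*)%mu.

HB.instance Definition _ (R : realType) (n : nat) := Measurable.on (Rn R n).

Definition lebesgue_Rn {R : realType} {n : nat} : set (Rn R n) -> \bar R :=
  @completed_measure_extension _ _ _ (@leb_borel R n).

HB.instance Definition _ (R : realType) (n : nat) :=
  Measure.on (@lebesgue_Rn R n).

HB.instance Definition _ (R : realType) (n : nat) :=
  Measure_isSigmaFinite.Build _ _ _ (@lebesgue_Rn R n)
    (completed_measure_extension_sigma_finite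
       (@sigma_finiteT _ _ _ (@leb_borel R n))).

Lemma lebesgue_Rn_complete (R : realType) (n : nat) :
  measure_is_complete (@lebesgue_Rn R n).
Proof. exact: measure_is_complete_caratheodory. Qed.

Lemma lebesgue_Rn_borel (R : realType) (n : nat)
    (A : set (n.-tuple (measurableTypeR R))) :
  measurable A ->
  measurable (A : set (Rn R n)) /\ lebesgue_Rn (A : set (Rn R n)) = leb_borel A.
Proof.
move=> mA; split; last exact: measurable_mu_extE.
by apply: sub_caratheodory; exact: sub_sigma_algebra.
Qed.

(* The Euclidean norm; the library norm on vectors is the sup norm. *)
Definition enorm {R : realType} {n : nat} (x : Rn R n) : R :=
  Num.sqrt (\sum_(i < n) (tnth x i) ^+ 2)%R.

Section function_spaces.
Context d (T : measurableType d) (R : realType).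
Variable mu : {measure set T -> \bar R}.

Definition is_weight (v : T -> \bar R) : Prop :=
  [/\ measurable_fun setT v, forall x, 0 < v x &
      {ae mu, forall x, v x < +oo}].

(* A Banach function space X is represented by its norm N, with values in
   [0, +oo], on all real functions but only constrained on the measurable ones:
   X is the set of measurable f such that N f < +oo. Invariance of N under a.e.
   equality follows from BFS_abs and BFS_le. *)
Record is_BFS (N : (T -> R) -> \bar R) : Prop := IsBFS {
  BFS_ge0 : forall f : T -> R, measurable_fun setT f -> 0 <= N f ;
  BFS_eq0 : forall f : T -> R, measurable_fun setT f ->
    N f = 0 <-> {ae mu, forall x, f x = 0%R} ;
  BFS_scale : forall (a : R) (f : T -> R), measurable_fun setT f ->
    N (fun x => a * f x)%R = `|a|%:E * N f ;
  BFS_triangle : forall f g : T -> R, measurable_fun setT f -> measurable_fun setT g ->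
    N (fun x => f x + g x)%R <= N f + N g ;
  BFS_abs : forall f : T -> R, measurable_fun setT f -> N f = N (fun x => `|f x|%R) ;
  BFS_le : forall f g : T -> R, measurable_fun setT f -> measurable_fun setT g ->
    {ae mu, forall x, (0 <= f x <= g x)%R} -> N f <= N g ;
  BFS_fatou : forall (F : (T -> R)^nat) (f : T -> R),
    (forall k, measurable_fun setT (F k)) -> measurable_fun setT f ->
    {ae mu, forall x, [/\ forall k, (0 <= F k x)%R,
      nondecreasing_seq (F ^~ x) & F k x @[k --> \oo] --> f x]} ->
    nondecreasing_seq (N \o F) /\ N (F k) @[k --> \oo] --> N f ;
  BFS_indic : forall E, measurable E -> mu E < +oo -> N \1_E < +oo ;
  BFS_integral : forall E, measurable E -> mu E < +oo ->
    exists2 C : R, (0 < C)%R &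
      forall f : T -> R, measurable_fun setT f -> (forall x, 0 <= f x)%R ->
        \int[mu]_(x in E) (f x)%:E <= C%:E * N f }.

(* N on extended real-valued functions: a function that is not a.e. finite is
   not in X, so its norm is +oo; otherwise fine only changes it on a null
   set. *)
Definition BFS_norm (N : (T -> R) -> \bar R) (f : T -> \bar R) : \bar R :=
  if `[< {ae mu, forall x, f x \is a fin_num} >] then N (fine \o f) else +oo.

Definition weighted_norm N (w f : T -> \bar R) : \bar R :=
  BFS_norm N (fun x => f x * w x).

Definition p_convex N (w : T -> \bar R) (p M : R) : Prop :=
  forall (m : nat) (f : 'I_m -> T -> R),
    (forall k, measurable_fun setT (f k) /\
               weighted_norm N w (EFin \o f k) < +oo) ->
    weighted_norm N w
      (fun x => ((\sum_(k < m) `|f k x| `^ p) `^ p^-1)%R%:E) <=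
    M%:E * (\sum_(k < m) (weighted_norm N w (EFin \o f k)) `^ p) `^ p^-1.

End function_spaces.

Section dual_hardy.
Context {R : realType} {n : nat}.
Implicit Types (v w f : Rn R n -> \bar R) (N : (Rn R n -> R) -> \bar R).

Definition dual_hardy f (x : Rn R n) : \bar R :=
  \int[lebesgue_Rn]_(y in [set y | (enorm x < enorm y)%R]) f y.

Definition hardy_inequality (p : R) v w N (C : R) : Prop :=
  forall f, measurable_fun setT f -> (forall x, 0 <= f x) ->
    weighted_norm lebesgue_Rn N w (dual_hardy f) <=
    C%:E * Lnorm lebesgue_Rn p%:E (fun y => f y * v y).

Definition best_constant (p : R) v w N (C : R) : Prop :=
  hardy_inequality p v w N C /\
  forall C' : R, (0 < C')%R -> hardy_inequality p v w N C' -> (C <= C')%R.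

(* (\int_{|y|>t} v^{-p'})^{1/p'}, as the L_{p'} norm of v^{-1} on {|y|>t}; for
   p = 1 the conjugate exponent is +oo and this is an essential supremum. *)
Definition dual_tail (p : R) v (t : R) : \bar R :=
  Lnorm lebesgue_Rn (hoelder_conjugate p%:E)
    (fun y => (\1_[set y | (t < enorm y)%R] y)%:E * (v y)^-1).

(* The powers gamma / p' and (1 - gamma) / p' are obtained as the powers gamma
   and 1 - gamma of dual_tail. *)
Definition hardy_B (p : R) v w N (gamma : R) : \bar R :=
  ereal_sup [set (dual_tail p v t) `^ gamma *
      weighted_norm lebesgue_Rn N w (fun x =>
        (\1_[set z | (enorm z < t)%R] x)%:E *
        (dual_tail p v (enorm x)) `^ (1 - gamma)%R)
    | t in [set t : R | (0 < t)%R]].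

End dual_hardy.

Section factors.
Context {R : realType}.
Local Open Scope ring_scope.

(* The value at p of an expression in p that is read at p = 1 as its limit
   from the right. *)
Definition at_exponent (F : R -> R) (p : R) : R :=
  if p == 1 then lim (F q @[q --> 1^'+]) else F p.

Definition lower_factor (gamma : R) : R -> R :=
  at_exponent (fun p => let p' := p / (p - 1) in
    p' / ((1 - gamma) *
      ((p' / (1 - gamma)) `^ p + (gamma * (p - 1))^-1) `^ p^-1)).

Definition upper_factor (gamma : R) : R -> R :=
  at_exponent (fun p => let p' := p / (p - 1) in
    ((1 - gamma) `^ p'^-1)^-1).

End factors.

(* Main.v *)
(* Write V(r) for the dual tail [(\int_{|y|>r} v^{-p'})^{1/p'}], W = V^{p'} and
   H f(r) = \int_{|y|>r} f. All functions of x that matter are of the form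
   phi(|x|) with phi nonincreasing and right-continuous, hence increasing limits
   of step functions on dyadic grids; by the Fatou property it is enough to
   bound these, and on a grid r_0 > r_1 > ... everything is a finite sum over
   shells, so that no regularity of W in r is needed.

   Sufficiency. Hoelder's inequality on each shell, followed by Hoelder's
   inequality for sums with weights V(r_k)^gamma, gives
     H f(r_i) <= (1 - gamma)^{-1/p'} (\sum_{k <= i} alpha_k V(r_k)^{gamma p})^{1/p}
                 V(r_i)^{1 - gamma},
   where alpha_k is the mass of (f v)^p on the k-th shell. Then p-convexity,
   applied to the functions alpha_k^{1/p} V(r_k)^gamma 1_{|x|<r_k} V(|x|)^{1-gamma},
   whose norms are at most alpha_k^{1/p} B(gamma), concludes.

   Necessity. For p > 1 the test function is v^{-p'} times a step function whose
   value on a shell (r, s] is the mean of p'/(1-gamma) u^{-beta} for u between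
   W(s) and W(r), with beta = 1 - (1-gamma)/p'. Its tail integrals telescope to
   p'/(1-gamma) V^{1-gamma}, and Jensen's inequality bounds its norm. For p = 1
   one takes a positive combination of indicators of sets on which 1/v is almost
   its essential supremum over {|y| > r_k}. *)

Require Import Defs.
From HB Require Import structures.
From mathcomp Require Import all_boot all_order all_algebra.
From mathcomp Require Import all_classical all_reals all_analysis.
From mathcomp Require Import measurable_realfun ess_sup_inf ring lra.

Set Implicit Arguments.
Unset Strict Implicit.
Unset Printing Implicit Defensive.

Import Order.TTheory GRing.Theory Num.Theory.
Import numFieldNormedType.Exports.

Local Open Scope classical_set_scope.
Local Open Scope ring_scope.

(** * Inequalities and limits for real powers *)

Section power_inequalities.
Context {R : realType}.
Implicit Types a b c p q beta gamma : R.

(** Young's inequality with the conjugate exponents [1 / gamma] and [1 / (1 - gamma)], applied to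
    [a ^ gamma] and [b ^ (1 - gamma)]. *)
Lemma powR_young gamma a b : 0 < gamma < 1 -> 0 <= a -> 0 <= b ->
  a `^ gamma * b `^ (1 - gamma) <= gamma * a + (1 - gamma) * b.
Proof.
move=> /andP[g0 g1] a0 b0.
have g1' : 0 < 1 - gamma by rewrite subr_gt0.
have := @conjugate_powR R (a `^ gamma) (b `^ (1 - gamma)) gamma^-1 (1 - gamma)^-1.
rewrite !powR_ge0 !invr_gt0 !invrK g0 g1' -!powRrM !mulfV ?gt_eqF//.
rewrite !powRr1// => /(_ isT isT isT isT) H.
by rewrite [gamma * a]mulrC [(1 - gamma) * b]mulrC; apply: H; ring.
Qed.

Lemma powR_secant_le gamma a b : 0 < gamma < 1 -> 0 < a -> 0 <= b ->
  (1 - gamma) * ((a - b) * a `^ (- gamma)) <= a `^ (1 - gamma) - b `^ (1 - gamma).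
Proof.
move=> /[dup] g01 /andP[g0 g1] a0 b0.
have ag0 : 0 < a `^ gamma by exact: powR_gt0.
have gE : gamma + (1 - gamma) = 1 by ring.
rewrite -(ler_pM2l ag0) powRN mulrBr -[X in _ <= X - _]powRD ?gE ?oner_eq0//.
rewrite powRr1 ?(ltW a0)// mulrCA (mulrCA _ (a - b)) mulfV ?gt_eqF// mulr1.
by have := powR_young g01 (ltW a0) b0; lra.
Qed.

(** The convex function [u ^ p] lies above its tangent at [c]: Young's inequality for the product of
    [u] and [c ^ (p - 1)], with exponents [p] and [p / (p - 1)]. *)
Lemma powR_tangent p u c : 1 < p -> 0 <= u -> 0 <= c ->
  c `^ p + p * (c `^ (p - 1) * (u - c)) <= u `^ p.
Proof.
move=> p1 u0 c0; have p0 : 0 < p by exact: lt_trans p1.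
have p10 : 0 < p - 1 by rewrite subr_gt0.
have := @conjugate_powR R u (c `^ (p - 1)) p (p / (p - 1)) u0 (powR_ge0 _ _) p0.
have -> : (c `^ (p - 1)) `^ (p / (p - 1)) = c `^ p.
  by rewrite -powRrM; congr powR; field; rewrite gt_eqF.
have E : c `^ p = c `^ (p - 1) * c.
  by rewrite -[X in _ = _ * X]powRr1// -powRD ?subrK// gt_eqF.
rewrite divr_gt0// => /(_ isT) H.
have {H} : u * c `^ (p - 1) <= u `^ p / p + c `^ p / (p / (p - 1)).
  by apply: H; field; rewrite !gt_eqF.
rewrite -(ler_pM2l p0) mulrDr (mulrCA p (u `^ p)) mulfV ?gt_eqF// mulr1.
have -> : p * (c `^ p / (p / (p - 1))) = (p - 1) * c `^ p.
  by field; rewrite !gt_eqF.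
by rewrite E; lra.
Qed.


(* Integrating the tangent-line inequality of [powR p] at the mean [c] of
   [s `^ - beta] over [b, a] is Jensen's inequality. *)
Lemma powR_mean_le p beta b a : 1 < p -> 0 < beta < 1 -> 1 < beta * p ->
  0 < b -> b <= a ->
  ((a `^ (1 - beta) - b `^ (1 - beta)) / ((1 - beta) * (a - b))) `^ p * (a - b) <=
  (b `^ (1 - beta * p) - a `^ (1 - beta * p)) / (beta * p - 1).
Proof.
move=> p1 /andP[beta0 beta1] bp1 b0 ba.
have p0 : 0 < p by exact: lt_trans p1.
have [->|ab] := eqVneq b a; first by rewrite !subrr mulr0 mul0r.
have {ab} ba' : b < a by rewrite lt_neqAle ab.
have ab0 : 0 < a - b by rewrite subr_gt0.
have beta1' : 0 < 1 - beta by rewrite subr_gt0.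
set c := _ / (_ * (a - b)).
have c0 : 0 <= c.
  rewrite divr_ge0// ?mulr_ge0 ?(ltW ab0) ?(ltW beta1')// subr_ge0.
  by rewrite ge0_ler_powR ?nnegrE ?(ltW b0) ?(ltW beta1')// (le_trans (ltW b0)).
(* [F] is an antiderivative of [dF], the gap between [u ^ p] and its tangent at [c], taken at
   [u = s ^ (- beta)]. The gap is nonnegative, so [F b <= F a] by the mean value theorem. *)
pose F (s : R) := (1 - beta * p)^-1 * s `^ (1 - beta * p) -
  (c `^ p * s + p * c `^ (p - 1) * ((1 - beta)^-1 * s `^ (1 - beta) - c * s)).
pose dF (s : R) := s `^ (- (beta * p)) -
  (c `^ p + p * c `^ (p - 1) * (s `^ (- beta) - c)).
have Fd (s : R) : 0 < s -> is_derive s 1 F (dF s).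
  move=> s0; rewrite /F.
  have H1 := @is_derive1_powR R (1 - beta * p) s s0.
  have H2 := @is_derive1_powR R (1 - beta) s s0.
  apply: is_derive_eq; rewrite /dF.
  rewrite !scaler1 /= /GRing.scale /=.
  rewrite !(addrAC 1 _ (-1)) !subrr !add0r.
  have h1 : 1 - beta * p != 0 by rewrite subr_eq0 eq_sym gt_eqF.
  have h2 : 1 - beta != 0 by rewrite gt_eqF.
  by field; rewrite h1 h2.
have [||s /itvP sba E] := @MVT_segment R F dF b a ba.
- by move=> s; rewrite in_itv/= => /andP[bs _]; apply: Fd; exact: lt_trans bs.
- apply: derivable_within_continuous => s /itvP sba.
  have s0 : 0 < s by rewrite (lt_le_trans b0)// sba.
  by have [] := Fd s s0.
have s0 : 0 < s by rewrite (lt_le_trans b0)// sba.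
have dF0 : 0 <= dF s.
  have := powR_tangent p1 (powR_ge0 s (- beta)) c0.
  by rewrite /dF -powRrM mulNr subr_ge0 mulrA.
(* As [c] is the mean of [s ^ (- beta)] over [[b, a]], the first-order term of the tangent
   integrates to zero. *)
have cE : (1 - beta)^-1 * (a `^ (1 - beta) - b `^ (1 - beta)) = c * (a - b).
  by rewrite /c; field; rewrite !gt_eqF.
have : 0 <= F a - F b by rewrite E mulr_ge0// ltW.
have -> : F a - F b = (b `^ (1 - beta * p) - a `^ (1 - beta * p)) / (beta * p - 1) -
    (c `^ p * (a - b) + p * c `^ (p - 1) *
    ((1 - beta)^-1 * (a `^ (1 - beta) - b `^ (1 - beta)) - c * (a - b))).
  rewrite /F -(opprB (beta * p) 1) invrN; ring.
by rewrite cE subrr mulr0 addr0 subr_ge0.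
Qed.

(** Integrated form of [1 / a <= 1 / s] against [s ^ (- gamma)] on [[b, a]]; after clearing
    denominators it is again [powR_young]. It makes the cost of the test function telescope when
    [p = 1]. *)
Lemma powR_slope_le gamma b a : 0 < gamma < 1 -> 0 < b -> b <= a ->
  gamma * ((a `^ (1 - gamma) - b `^ (1 - gamma)) / a) <=
  (1 - gamma) * (b `^ (- gamma) - a `^ (- gamma)).
Proof.
move=> /[dup] g01 /andP[g0 g1] b0 ba.
have a0 : 0 < a by exact: lt_le_trans ba.
have ag0 : 0 < a `^ gamma by exact: powR_gt0.
have bg0 : 0 < b `^ gamma by exact: powR_gt0.
have E (x : R) : 0 < x -> x `^ (1 - gamma) = x / x `^ gamma.
  move=> x0; have xg0 : 0 < x `^ gamma by exact: powR_gt0.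
  apply: (mulfI (lt0r_neq0 xg0)); rewrite mulrCA mulfV ?gt_eqF// mulr1.
  have gE : gamma + (1 - gamma) = 1 by ring.
  by rewrite -powRD ?gE ?oner_eq0// powRr1// ltW.
rewrite !E// !powRN -subr_ge0.
have Y := powR_young g01 (ltW b0) (ltW a0).
have -> : (1 - gamma) * ((b `^ gamma)^-1 - (a `^ gamma)^-1) -
    gamma * ((a / a `^ gamma - b / b `^ gamma) / a) =
    (a `^ gamma * (gamma * b + (1 - gamma) * a) - a * b `^ gamma) /
    (a * a `^ gamma * b `^ gamma).
  by field; rewrite !gt_eqF.
rewrite divr_ge0 ?mulr_ge0 ?powR_ge0 ?(ltW a0)// subr_ge0.
apply: le_trans (ler_wpM2l (ltW ag0) Y).
by rewrite E// le_eqVlt; apply/orP; left; apply/eqP; field; rewrite gt_eqF.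
Qed.

End power_inequalities.

(** * Limits of the numerical factors as the exponent tends to 1 from the right *)

Section factors_at_one.
Context {R : realType}.
Implicit Types gamma : R.

Lemma cvg_right1_subr1 : (q - 1) @[q --> (1 : R)^'+] --> (0 : R).
Proof.
rewrite -(subrr (1 : R)); apply: cvgB; last exact: cvg_cst.
exact: cvg_at_right_filter.
Qed.

(** The lower bound is [ln y < y] at [y = 1 / sqrt u], together with [ln u = 2 ln (sqrt u)]. *)
Lemma ln_mul_bound (u : R) : 0 < u -> u < 1 -> - (2 * Num.sqrt u) <= u * ln u <= 0.
Proof.
move=> u0 u1; apply/andP; split; last first.
  by rewrite pmulr_rle0// ln_le0// ltW.
have su : 0 < Num.sqrt u by rewrite sqrtr_gt0.
have uE : u = Num.sqrt u ^+ 2 by rewrite sqr_sqrtr// ltW.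
have := @ln_sublinear R (Num.sqrt u)^-1.
rewrite invr_gt0 => /(_ su).
rewrite lnV ?posrE// => H.
have -> : ln u = 2 * ln (Num.sqrt u) by rewrite {1}uE expr2 lnM ?posrE//; ring.
rewrite {2}uE expr2.
have : - (Num.sqrt u)^-1 <= ln (Num.sqrt u) by lra.
rewrite -(ler_pM2l (mulr_gt0 su su)).
have -> : Num.sqrt u * Num.sqrt u * - (Num.sqrt u)^-1 = - Num.sqrt u.
  by field; rewrite gt_eqF.
lra.
Qed.

Lemma cvg_right1_xlnx : (q - 1) * ln (q - 1) @[q --> (1 : R)^'+] --> (0 : R).
Proof.
apply: (@squeeze_cvgr _ _ _ _ (fun q => - (2 * Num.sqrt (q - 1))) (fun=> 0)).
- near=> q; apply: ln_mul_bound.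
    by rewrite subr_gt0; near: q; exact: nbhs_right_gt.
  by rewrite ltrBlDr; near: q; apply: nbhs_right_lt; rewrite ltrDl.
- rewrite -oppr0; apply: cvgN; rewrite -(mulr0 2); apply: cvgM; first exact: cvg_cst.
  rewrite -[X in _ --> X](@sqrtr0 R).
  exact: (cvg_comp _ _ cvg_right1_subr1 (@sqrt_continuous R 0)).
- exact: cvg_cst.
Unshelve. all: by end_near. Qed.

(** The exponent [1 / q' = (q - 1) / q] tends to 0, so the power of the fixed base [1 - gamma] tends
    to 1. *)
Lemma upper_factor1 gamma : 0 < gamma < 1 -> upper_factor gamma 1 = 1.
Proof.
move=> /andP[g0 g1]; rewrite /upper_factor /at_exponent eqxx.
apply: cvg_lim => //.
rewrite -[X in _ --> X]invr1; apply: cvgV; first exact: oner_neq0.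
rewrite [X in _ --> X](_ : _ = expR (0 * ln (1 - gamma))); last first.
  by rewrite mul0r expR0.
have E : \forall q \near (1 : R)^'+,
    expR ((q - 1) / q * ln (1 - gamma)) = (1 - gamma) `^ (q / (q - 1))^-1.
  near=> q; rewrite /powR subr_eq0 gt_eqF// invf_div//.
apply: (cvg_trans (near_eq_cvg E)).
apply: cvg_comp; last exact: continuous_expR.
apply: cvgM; last exact: cvg_cst.
rewrite -[X in _ --> X](mul0r (1^-1)); apply: cvgM; first exact: cvg_right1_subr1.
apply: cvgV; first exact: oner_neq0.
exact: cvg_at_right_filter.
Unshelve. all: by end_near. Qed.

(** With [P = q' / (1 - gamma)], factoring [P ^ q] out of the bracket leaves [D q] and cancels the
    numerator. The factor is thus [D q ^ (- 1 / q)], and [D q] tends to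
    [1 + (1 - gamma) / gamma = 1 / gamma]. *)
Lemma lower_factor1 gamma : 0 < gamma < 1 -> lower_factor gamma 1 = gamma.
Proof.
move=> /andP[g0 g1]; rewrite /lower_factor /at_exponent eqxx.
have g1' : 0 < 1 - gamma by rewrite subr_gt0.
(* The exponential is [1 / ((q - 1) P ^ q)]; in logarithmic form its only delicate term is
   [(q - 1) ln (q - 1)], which tends to 0. *)
pose D (q : R) := 1 +
  expR (q * ln (1 - gamma) - q * ln q + (q - 1) * ln (q - 1)) / gamma.
have E : \forall q \near (1 : R)^'+, expR (- (q^-1 * ln (D q))) =
   q / (q - 1) / ((1 - gamma) *
   ((q / (q - 1) / (1 - gamma)) `^ q + (gamma * (q - 1))^-1) `^ q^-1).
  near=> q.
  have q1 : 1 < q by near: q; exact: nbhs_right_gt.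
  have u0 : 0 < q - 1 by rewrite subr_gt0.
  have q0 : 0 < q by exact: lt_trans q1.
  have D0 : 0 < D q by rewrite addr_gt0// divr_gt0// expR_gt0.
  set P := q / (q - 1) / (1 - gamma).
  have P0 : 0 < P by rewrite !divr_gt0.
  have lnP : ln P = ln q - ln (q - 1) - ln (1 - gamma).
    by rewrite /P !lnM ?posrE ?invr_gt0 ?divr_gt0// !lnV ?posrE.
  have DP : P `^ q + (gamma * (q - 1))^-1 = P `^ q * D q.
    rewrite [RHS]mulrDr mulr1; congr +%R.
    rewrite /powR (gt_eqF P0) mulrA -expRD lnP.
    have -> : q * (ln q - ln (q - 1) - ln (1 - gamma)) +
      (q * ln (1 - gamma) - q * ln q + (q - 1) * ln (q - 1)) = - ln (q - 1) by ring.
    by rewrite expRN lnK ?posrE// invfM mulrC.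
  rewrite DP powRM ?powR_ge0 ?(ltW D0)// -powRrM mulfV ?gt_eqF// powRr1 ?(ltW P0)//.
  rewrite /powR (gt_eqF D0) expRN /P; field.
  by rewrite !gt_eqF// expR_gt0.
apply: cvg_lim => //.
suff : expR (- (q^-1 * ln (D q))) @[q --> (1 : R)^'+] --> gamma.
  by move=> H; apply: cvg_trans H; exact: near_eq_cvg E.
have qcvg : (q : R) @[q --> (1 : R)^'+] --> (1 : R).
  exact: cvg_at_right_filter.
have Dcvg : D q @[q --> (1 : R)^'+] --> gamma^-1.
  rewrite [X in _ --> X](_ : _ =
    1 + expR (1 * ln (1 - gamma) - 1 * ln 1 + 0) / gamma); last first.
    rewrite ln1 mulr0 subr0 addr0 mul1r lnK ?posrE//; field; exact: lt0r_neq0.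
  apply: cvgD; first exact: cvg_cst.
  apply: cvgM; last exact: cvg_cst.
  apply: cvg_comp; last exact: continuous_expR.
  apply: cvgD; last exact: cvg_right1_xlnx.
  have lncvg : ln q @[q --> (1 : R)^'+] --> ln (1 : R).
    by apply: cvg_comp; [exact: qcvg|exact: continuous_ln].
  by apply: cvgB; apply: cvgM => //; exact: cvg_cst.
rewrite [X in _ --> X](_ : _ = expR (- (1^-1 * ln gamma^-1))); last first.
  by rewrite invr1 mul1r lnV ?posrE// opprK lnK.
apply: cvg_comp; last exact: continuous_expR.
apply: cvgN; apply: cvgM; first by apply: cvgV => //; exact: oner_neq0.
apply: cvg_comp; first exact: Dcvg.
by apply: continuous_ln; rewrite invr_gt0.
Unshelve. all: by end_near. Qed.

End factors_at_one.

(** * The scalar inequality behind the addition of one shell *)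

Section hoelder_step.
Context {R : realType}.
Implicit Types (p gamma : R).

Lemma upper_factorE gamma p : 1 < p ->
  upper_factor gamma p = ((1 - gamma) `^ (p / (p - 1))^-1)^-1.
Proof. by move=> p1; rewrite /upper_factor /at_exponent gt_eqF. Qed.

Lemma upper_factor_gt0 gamma p : 0 < gamma < 1 -> 1 <= p -> 0 < upper_factor gamma p.
Proof.
move=> /[dup] g01 /andP[g0 g1].
rewrite le_eqVlt => /predU1P[<-|p1]; first by rewrite upper_factor1.
by rewrite upper_factorE// invr_gt0 powR_gt0// subr_gt0.
Qed.

(* Hoelder for two terms, then [powR_secant_le] at [a `^ p'] and [b `^ p']. *)
Lemma upper_factor_step gamma p (A alpha a b c : R) : 0 < gamma < 1 -> 1 < p ->
  0 <= A -> 0 <= alpha -> 0 < a -> 0 <= b -> 0 <= c ->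
  a `^ (p / (p - 1)) = c `^ (p / (p - 1)) + b `^ (p / (p - 1)) ->
  upper_factor gamma p * A `^ p^-1 * b `^ (1 - gamma) + alpha `^ p^-1 * c <=
  upper_factor gamma p * (A + alpha * a `^ (gamma * p)) `^ p^-1 * a `^ (1 - gamma).
Proof.
move=> /[dup] g01 /andP[g0 g1] p1 A0 alpha0 a0 b0 c0.
have p0 : 0 < p by exact: lt_trans p1.
have p1' : 0 < p - 1 by rewrite subr_gt0.
set q := p / (p - 1) => abc.
have q0 : 0 < q by rewrite divr_gt0.
have pq : p^-1 + q^-1 = 1 by rewrite /q; field; rewrite !gt_eqF.
have k0 : 0 < upper_factor gamma p by rewrite upper_factor_gt0// ltW.
have kq : upper_factor gamma p `^ q = (1 - gamma)^-1.
  rewrite upper_factorE// -/q -powRN -powRrM mulNr mulVf ?gt_eqF//.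
  by rewrite powR_inv1// subr_ge0 ltW.
have ag0 : 0 < a `^ gamma by exact: powR_gt0.
have g1' : 0 < 1 - gamma by rewrite subr_gt0.
(* The factor [a ^ (- gamma)] attached to [c] compensates the weight [a ^ (gamma p)] attached to
   [alpha]. *)
have H := @hoelder2 R (A `^ p^-1) ((alpha * a `^ (gamma * p)) `^ p^-1)
  (upper_factor gamma p * b `^ (1 - gamma)) (c * a `^ (- gamma)) p q
  (powR_ge0 _ _) (powR_ge0 _ _) (mulr_ge0 (ltW k0) (powR_ge0 _ _))
  (mulr_ge0 c0 (powR_ge0 _ _)) p0 q0 pq.
have pK (x : R) : 0 <= x -> (x `^ p^-1) `^ p = x.
  by move=> x0; rewrite -powRrM mulVf ?gt_eqF// powRr1.
rewrite !pK ?mulr_ge0 ?powR_ge0// in H.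
have a2E : (alpha * a `^ (gamma * p)) `^ p^-1 = alpha `^ p^-1 * a `^ gamma.
  by rewrite powRM ?powR_ge0// -powRrM mulfK ?gt_eqF.
rewrite a2E in H.
apply: le_trans (le_trans H _).
  rewrite le_eqVlt; apply/orP; left; apply/eqP; rewrite powRN.
  by field; rewrite gt_eqF.
rewrite -(mulrA (upper_factor _ _)) mulrCA.
apply: ler_wpM2l; first exact: powR_ge0.
rewrite powRM ?powR_ge0 ?(ltW k0)// kq powRM ?powR_ge0//.
rewrite -!powRrM.
have -> : upper_factor gamma p * a `^ (1 - gamma) =
    ((1 - gamma)^-1 * (a `^ q) `^ (1 - gamma)) `^ q^-1.
  have aE : ((a `^ q) `^ (1 - gamma)) `^ q^-1 = a `^ (1 - gamma).
    by rewrite -!powRrM; congr (_ `^ _); field; rewrite gt_eqF.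
  rewrite powRM ?powR_ge0 ?invr_ge0 ?(ltW g1')// aE; congr (_ * _).
  by rewrite -kq -powRrM mulfV ?gt_eqF// powRr1// ltW.
apply: ge0_ler_powR; rewrite ?nnegrE ?invr_ge0 ?(ltW q0)//.
- by rewrite addr_ge0 ?mulr_ge0 ?powR_ge0 ?invr_ge0 ?subr_ge0 ?(ltW g1).
- by rewrite mulr_ge0 ?powR_ge0 ?invr_ge0 ?subr_ge0 ?(ltW g1).
have S := powR_secant_le g01 (powR_gt0 q a0) (powR_ge0 b q).
have -> : c `^ q = a `^ q - b `^ q by rewrite abc addrK.
rewrite !(mulrC _ q) !(powRrM _ q) -lerBrDl -mulrBr.
by rewrite ler_pdivlMl.
Qed.

End hoelder_step.

Section lower_factor_theory.
Context {R : realType}.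
Implicit Types p gamma : R.

Lemma lower_factorE gamma p : 1 < p ->
  lower_factor gamma p = p / (p - 1) / (1 - gamma) /
    ((p / (p - 1) / (1 - gamma)) `^ p + (gamma * (p - 1))^-1) `^ p^-1.
Proof. by move=> p1; rewrite /lower_factor /at_exponent gt_eqF//= invfM mulrA. Qed.

Lemma lower_factor_gt0 gamma p : 0 < gamma < 1 -> 1 <= p -> 0 < lower_factor gamma p.
Proof.
move=> /[dup] g01 /andP[g0 g1].
rewrite le_eqVlt => /predU1P[<-|p1]; first by rewrite lower_factor1.
have p0 : 0 < p by exact: lt_trans p1.
rewrite lower_factorE// !divr_gt0 ?subr_gt0// powR_gt0// addr_gt0//.
  by rewrite powR_gt0// !divr_gt0 ?subr_gt0.
by rewrite invr_gt0 mulr_gt0// subr_gt0.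
Qed.

End lower_factor_theory.

(** * Dyadic grids *)

Section dyadic_ceiling.
Context {R : realType}.
Implicit Types (t r : R) (m : nat).

(** For [0 <= r], the first multiple of [t / 2 ^ m] strictly to the right of [r]. The [.+1] gives
    strictness also at grid points, as the condition [rho x < s j] on grids requires. *)
Definition dyadic_ceil t m r : R := t * (Num.truncn (r / t * 2 ^+ m)).+1%:R / 2 ^+ m.

Let exp2_gt0 m : 0 < 2 ^+ m :> R.
Proof. by rewrite exprn_gt0. Qed.

Lemma dyadic_ceil_gt t m r : 0 < t -> r < dyadic_ceil t m r.
Proof.
move=> t0; rewrite /dyadic_ceil ltr_pdivlMr// -ltr_pdivrMl//.
by rewrite mulrA (mulrC t^-1) truncnS_gt.
Qed.

Lemma dyadic_ceil_le t m r : 0 < t -> 0 <= r -> dyadic_ceil t m r <= r + t / 2 ^+ m.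
Proof.
move=> t0 r0; rewrite /dyadic_ceil -natr1 mulrDr mulr1 mulrDl lerD2r.
rewrite ler_pdivrMr// -ler_pdivlMl// mulrA (mulrC t^-1) truncn_le.
by rewrite mulr_ge0 ?divr_ge0 ?(ltW (exp2_gt0 _)) ?(ltW t0).
Qed.

Lemma dyadic_ceil_homo t m : 0 < t -> {homo dyadic_ceil t m : r s / r <= s}.
Proof.
move=> t0 r s rs; rewrite /dyadic_ceil ler_pM2r ?invr_gt0// ler_pM2l// ler_nat ltnS.
by rewrite le_truncn// ler_pM2r// ler_pM2r// invr_gt0.
Qed.

(** The grids are nested: the truncation of [2 y] is at most [2 k + 1], where [k] is that of [y]. *)
Lemma dyadic_ceilS t m r : 0 < t -> dyadic_ceil t m.+1 r <= dyadic_ceil t m r.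
Proof.
move=> t0; rewrite /dyadic_ceil exprS.
set y := r / t * 2 ^+ m.
have -> : r / t * (2 * 2 ^+ m) = 2 * y by rewrite /y; ring.
have -> : t * (Num.truncn y).+1%:R / 2 ^+ m =
    t * (2 * (Num.truncn y).+1)%:R / (2 * 2 ^+ m).
  by rewrite natrM; field; rewrite gt_eqF.
rewrite ler_pM2r ?invr_gt0 ?mulr_gt0// ler_pM2l// ler_nat mul2n doubleS ltnS.
rewrite truncn_le_nat -doubleS -mul2n natrM ltr_pM2l//.
exact: truncnS_gt.
Qed.

Lemma dyadic_ceil_near t r s : 0 < t -> 0 <= r -> r < s ->
  exists m, dyadic_ceil t m r <= s.
Proof.
move=> t0 r0 rs; exists (Num.truncn (t / (s - r))).+1.
apply: (le_trans (dyadic_ceil_le _ t0 r0)); rewrite addrC -lerBrDr.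
rewrite ler_pdivrMr// mulrC -ler_pdivrMr ?subr_gt0//.
apply: (le_trans (ltW (truncnS_gt _))); rewrite -natrX ler_nat ltnW//.
exact: ltn_expl.
Qed.

End dyadic_ceiling.

Lemma indic_boolE (T : Type) (R : pzRingType) (P : pred T) (x : T) :
  \1_[set z | P z] x = (P x)%:R :> R.
Proof. by rewrite indicE (_ : (x \in _) = P x)//; apply/idP/idP; rewrite inE. Qed.

Local Open Scope ereal_scope.

(** * Norms of Banach function spaces *)

Local Open Scope ereal_scope.

Lemma cvgn_le (R : realType) (u : (\bar R)^nat) (l c : \bar R) :
  u k @[k --> \oo] --> l -> (forall k, u k <= c) -> l <= c.
Proof. by move=> ul uc; apply: cvge_le ul; near=> k. Unshelve. all: by end_near. Qed.

Lemma nondecreasing_cvgn_lee (R : realType) (u : (\bar R)^nat) (l : \bar R) k :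
  nondecreasing_seq u -> u k @[k --> \oo] --> l -> u k <= l.
Proof.
move=> ndu /(cvg_unique _ (ereal_nondecreasing_cvgn ndu)) <- //.
by apply: ereal_sup_ubound; exists k.
Qed.

Lemma ae_measure0 d (T : measurableType d) (R : realType)
    (mu : {measure set T -> \bar R}) (P : T -> Prop) (A : set T) :
  measurable A -> {ae mu, forall x, P x} -> (forall x, A x -> ~ P x) -> mu A = 0.
Proof.
move=> mA aeP AP; apply: measure_negligible => //.
by apply: negligibleS aeP => x /AP.
Qed.

Section BFS_norm_theory.
Context d (T : measurableType d) (R : realType).
Variable mu : {sigma_finite_measure set T -> \bar R}.
Variable N : (T -> R) -> \bar R.
Hypothesis N_BFS : is_BFS mu N.
Implicit Types F G : T -> \bar R.

Let measurable_fine F : measurable_fun setT F -> measurable_fun setT (fine \o F).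
Proof. by move=> mF; exact: measurableT_comp. Qed.

Lemma BFS_norm_ge0 F : measurable_fun setT F -> 0 <= BFS_norm mu N F.
Proof.
move=> mF; rewrite /BFS_norm; case: ifP => // _.
by apply: (BFS_ge0 N_BFS); exact: measurable_fine.
Qed.

Lemma BFS_norm_le F G : measurable_fun setT F -> measurable_fun setT G ->
  (forall x, 0 <= F x <= G x) -> BFS_norm mu N F <= BFS_norm mu N G.
Proof.
move=> mF mG FG; rewrite /BFS_norm.
case: (asboolP {ae mu, forall x, G x \is a fin_num}) => [Gfin|_]; last exact: leey.
have Ffin x : G x \is a fin_num -> F x \is a fin_num.
  have /andP[F0 FGx] := FG x => Gx; rewrite ge0_fin_numE//.
  by rewrite (le_lt_trans FGx)// ltey_eq Gx.
rewrite asboolT; last by apply: filterS Gfin => x /Ffin.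
apply: (BFS_le N_BFS); [exact: measurable_fine|exact: measurable_fine|].
apply: filterS Gfin => x Gx /=; have /andP[F0 FGx] := FG x.
by rewrite fine_ge0//= fine_le// Ffin.
Qed.

Lemma BFS_normZ (a : R) F : (0 <= a)%R -> measurable_fun setT F ->
  (forall x, 0 <= F x) ->
  BFS_norm mu N (fun x => a%:E * F x) = a%:E * BFS_norm mu N F.
Proof.
move=> a0 mF F0.
have fineZ : fine \o (fun x => a%:E * F x) = (fun x => a * (fine \o F) x)%R.
  apply/funext => x /=; move: (F0 x); case: (F x) => //= _.
  rewrite mulr0; move: a0; rewrite le_eqVlt => /predU1P[<-|a0].
    by rewrite mul0e.
  by rewrite gt0_muley.
have NZ := BFS_scale N_BFS a (measurable_fine mF).
move: a0; rewrite le_eqVlt => /predU1P[a0|a0].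
  (* For [a = 0] both sides vanish even if [F] is not a.e. finite, because [0 * +oo = 0]. *)
  rewrite -a0 mul0e /BFS_norm asboolT; last first.
    by apply: filterE => x; rewrite mul0e.
  by move: NZ; rewrite -fineZ -a0 normr0 mul0e.
rewrite /BFS_norm; case: (asboolP {ae mu, forall x, F x \is a fin_num}) => Ffin.
  rewrite asboolT.
    by rewrite fineZ NZ gtr0_norm.
  by apply: filterS Ffin => x Fx; rewrite fin_numM.
rewrite asboolF ?gt0_muley ?lte_fin// => aFfin; apply: Ffin.
apply: filterS aFfin => x; case: (F x) => //; rewrite ?gt0_muley ?gt0_muleNy//.
Qed.

Lemma BFS_norm_gt0 F (A : set T) : measurable A -> 0 < mu A ->
  measurable_fun setT F -> (forall x, 0 <= F x) -> (forall x, A x -> 0 < F x) ->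
  0 < BFS_norm mu N F.
Proof.
move=> mA A0 mF F0 FA; rewrite lt_neqAle BFS_norm_ge0// andbT.
apply/eqP => /esym; rewrite /BFS_norm; case: asboolP => // Ffin.
move/(BFS_eq0 N_BFS (measurable_fine mF)) => F_0.
suff muA : mu A = 0 by rewrite muA ltxx in A0.
apply: (ae_measure0 (P := fun x => F x = 0)) => //; last first.
  by move=> x /FA Fx0 Fx; rewrite Fx ltxx in Fx0.
by apply: filterS2 Ffin F_0 => x Fx /= F_0; rewrite -(fineK Fx) F_0.
Qed.

(** Continuity from below along a sigma-finite exhaustion: if every piece of [A] were null, so would
    be [A]. *)
Lemma sigma_finite_subset_gt0 (A : set T) : measurable A -> 0 < mu A ->
  exists B, [/\ measurable B, B `<=` A, 0 < mu B & mu B < +oo].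
Proof.
move=> mA A0.
have /sigma_finiteP[S [ST ndS Soo]] := sigma_finiteT mu.
have mAS k : measurable (A `&` S k) by apply: measurableI => //; case: (Soo k).
have cv : mu (A `&` S k) @[k --> \oo] --> mu A.
  rewrite -[in X in _ --> X](setIT A) ST setI_bigcupr.
  apply: nondecreasing_cvg_mu => //; first exact: bigcupT_measurable.
  move=> i j ij; apply/subsetPset; apply: setIS.
  by apply/subsetPset; exact: ndS.
have [k k0] : exists k, 0 < mu (A `&` S k).
  apply/not_existsP => H.
  have E : (fun k => mu (A `&` S k)) = cst 0.
    apply/funext => k; apply/eqP; rewrite eq_le measure_ge0 andbT leNgt.
    by apply/negP; exact: H.
  move: cv; rewrite E => /cvg_lim; rewrite lim_cst// => muA.
  by rewrite -muA// ltxx in A0.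
exists (A `&` S k); split => //.
have [mS Sk] := Soo k.
by apply: le_lt_trans Sk; apply: le_measure; rewrite ?inE.
Qed.

(** The point is that [f] is a.e. finite. Otherwise [f = +oo] on a set [B] of positive finite
    measure, whereas [BFS_integral] and monotone convergence bound the integral of [f] over [B] by a
    multiple of [c]. The Fatou property of [N] then applies to the finite parts. *)
Lemma BFS_norm_fatou (F : (T -> \bar R)^nat) (f : T -> \bar R) (c : \bar R) :
  (forall k, measurable_fun setT (F k)) -> measurable_fun setT f ->
  (forall k x, 0 <= F k x) -> (forall x, nondecreasing_seq (F ^~ x)) ->
  (forall x, F k x @[k --> \oo] --> f x) ->
  (forall k, BFS_norm mu N (F k) <= c) -> BFS_norm mu N f <= c.
Proof.
move=> mF mf F0 ndF Ff Fc.
have [->|coo] := eqVneq c +oo; first exact: leey.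
have Ffin k : {ae mu, forall x, F k x \is a fin_num}.
  move: (Fc k); rewrite /BFS_norm; case: asboolP => //.
  by rewrite leye_eq (negbTE coo).
have NFc k : N (fine \o F k) <= c.
  by have := Fc k; rewrite /BFS_norm asboolT.
have c0 : 0 <= c by apply: le_trans (Fc 0%N); exact: BFS_norm_ge0.
have Ff_le k x : F k x <= f x.
  exact: nondecreasing_cvgn_lee (ndF x) (Ff x).
have f0 x : 0 <= f x by exact: le_trans (F0 0%N x) (Ff_le 0%N x).
have ffin : {ae mu, forall x, f x \is a fin_num}.
  pose A := f @^-1` [set +oo].
  have mA : measurable A.
    by rewrite -[A]setTI; apply: mf => //; exact: emeasurable_set1.
  suff muA : mu A = 0.
    have negA : mu.-negligible A by apply/negligibleP.
    apply: negligibleS negA => x /= /negP fx; apply/eqP; rewrite -leye_eq.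
    by move: fx; rewrite ge0_fin_numE// -leNgt.
  apply/eqP; rewrite eq_le measure_ge0 andbT leNgt; apply/negP.
  move/(sigma_finite_subset_gt0 mA) => [B [mB BA B0 Boo]].
  have [C C0 HC] := BFS_integral N_BFS mB Boo.
  have intc k : \int[mu]_(x in B) F k x <= C%:E * c.
    apply: (@le_trans _ _ (\int[mu]_(x in B) ((fine \o F k) x)%:E)).
      apply: ae_ge0_le_integral => //.
      - exact: measurable_funTS.
      - by move=> x _ /=; rewrite lee_fin fine_ge0.
      - apply: measurable_funTS; apply/measurable_EFinP; exact: measurable_fine.
      - by apply: filterS (Ffin k) => x Fx _ /=; rewrite fineK.
    apply: le_trans (HC _ (measurable_fine (mF k)) _) _.
      by move=> x; rewrite fine_ge0.
    by rewrite lee_pmul2l.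
  have cvgB : \int[mu]_(x in B) F k x @[k --> \oo] --> \int[mu]_(x in B) f x.
    rewrite (_ : \int[mu]_(x in B) f x = \int[mu]_(x in B) (limn (F ^~ x))).
      apply: cvg_monotone_convergence => //.
      by move=> k; exact: measurable_funTS.
    by apply: eq_integral => x _; apply/esym/cvg_lim => //; exact: Ff.
  have : \int[mu]_(x in B) f x <= C%:E * c.
    exact: cvgn_le cvgB intc.
  rewrite (eq_integral (cst +oo)); last first.
    by move=> x; rewrite inE => /BA.
  rewrite integral_cst// gt0_mulye// leye_eq => /eqP Coo.
  have : C%:E * c < +oo by rewrite lte_mul_pinfty ?lee_fin ?(ltW C0)// ltey.
  by rewrite Coo.
rewrite /BFS_norm asboolT//.
have [_ cv] : nondecreasing_seq (N \o (fun k => fine \o F k)) /\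
    N (fine \o F k) @[k --> \oo] --> N (fine \o f).
  apply: (BFS_fatou N_BFS).
  - by move=> k; exact: measurable_fine.
  - exact: measurable_fine.
  - apply: filterS ffin => x fx.
    have Fx k : F k x \is a fin_num.
      by rewrite ge0_fin_numE// (le_lt_trans (Ff_le k x))// ltey_eq fx.
    split.
    + by move=> k /=; rewrite fine_ge0.
    + by move=> i j ij /=; rewrite fine_le//; exact: ndF.
    + by apply: fine_cvg; rewrite fineK//; exact: Ff.
exact: cvgn_le cv NFc.
Qed.

End BFS_norm_theory.

(** * Monotone functions of the radius and their approximation on grids *)

Section radial.
Context d (T : measurableType d) (R : realType).
Variable rho : T -> R.
Hypotheses (mrho : measurable_fun setT rho) (rho_ge0 : forall x, (0 <= rho x)%R).
Implicit Types phi : R -> \bar R.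

(** No continuity of [phi] is involved: the superlevel sets of a nonincreasing function are
    intervals. *)
Lemma measurable_antitone phi : (forall r s, (r <= s)%R -> phi s <= phi r) ->
  measurable_fun setT (phi \o rho).
Proof.
move=> nphi; apply: measurableT_comp => //.
move=> mD; apply: (measurability _ (ErealGenCInfty.measurableE R)) => //.
move=> _ [_ [r ->] <-]; rewrite setTI; apply: is_interval_measurable.
move=> a b /=; rewrite !in_itv/= !andbT => ra rb c /andP[ac cb].
by rewrite in_itv/= andbT (le_trans rb)// nphi.
Qed.

Variables (mu : {sigma_finite_measure set T -> \bar R}) (N : (T -> R) -> \bar R).
Variable w : T -> \bar R.
Hypotheses (N_BFS : is_BFS mu N) (w_weight : is_weight mu w).

Local Notation Nw := (weighted_norm mu N w).

Lemma weighted_norm_fatou (F : (T -> \bar R)^nat) (f : T -> \bar R) (c : \bar R) :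
  (forall k, measurable_fun setT (F k)) ->
  (forall k x, 0 <= F k x) -> (forall x, nondecreasing_seq (F ^~ x)) ->
  (forall x, F k x @[k --> \oo] --> f x) ->
  (forall k, Nw (F k) <= c) -> Nw f <= c.
Proof.
move=> mF F0 ndF Ff Fc; have [mw w0 _] := w_weight.
have mf : measurable_fun setT f.
  apply: (emeasurable_fun_cvg F) => // x _; exact: Ff.
apply: (BFS_norm_fatou N_BFS (F := fun k x => F k x * w x)) => //.
- by move=> k; exact: emeasurable_funM.
- exact: emeasurable_funM.
- by move=> k x; rewrite mule_ge0// ltW.
- by move=> x i j ij; apply: lee_wpmul2r; [exact: ltW|exact: ndF].
(* A weight may take the value [+oo] on a null set, where multiplication is not continuous at 0.
   Where [f x = 0], all the [F k x] vanish and the products are constantly 0. *)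
- move=> x; have := nondecreasing_cvgn_lee 0%N (ndF x) (Ff x).
  move/(le_trans (F0 0%N x)); rewrite le_eqVlt => /predU1P[fx|fx].
    rewrite -fx mul0e; apply: cvg_near_cst; near=> k.
    suff -> : F k x = 0 by rewrite mul0e.
    apply/eqP; rewrite eq_le F0 andbT fx.
    exact: nondecreasing_cvgn_lee (ndF x) (Ff x).
  apply: cvgeM; [|exact: Ff|exact: cvg_cst].
  by rewrite mule_defE (gt_eqF fx) (gt_eqF (w0 x)).
Unshelve. all: by end_near. Qed.

(* A step function below [phi \o rho] on a grid [s] of [0, t] suffices, by the
   Fatou property along dyadic grids and right-continuity of [phi]. *)
Lemma radial_fatou phi (t : R) (c : \bar R) : (0 < t)%R ->
  (forall r s, (r <= s)%R -> phi s <= phi r) -> (forall r, 0 <= phi r) ->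
  (forall r z, (forall r', (r < r')%R -> phi r' <= z) -> phi r <= z) ->
  (forall K (s : nat -> R) F, s 0%N = t -> (forall i, (i <= K)%N -> (0 < s i)%R) ->
    {homo s : i j / (i <= j)%N >-> (j <= i)%R} ->
    measurable_fun setT F -> (forall x, 0 <= F x) ->
    (forall x, F x = 0 \/ exists j, [/\ (j <= K)%N, (rho x < s j)%R & F x = phi (s j)]) ->
    Nw F <= c) ->
  Nw (fun x => (\1_[set z | (rho z < t)%R] x)%:E * phi (rho x)) <= c.
Proof.
move=> t0 nphi phi0 rphi H; pose tau m := dyadic_ceil t m.
pose psi m r := if (r < t)%R then phi (Order.min (tau m r) t) else 0.
have npsi m r s : (r <= s)%R -> psi m s <= psi m r.
  move=> rs; rewrite /psi; case: ltP => st; last by case: ifP.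
  rewrite (le_lt_trans rs st); apply: nphi; rewrite le_min !ge_min lexx orbT andbT.
  by rewrite dyadic_ceil_homo.
have psi_ge0 m r : 0 <= psi m r by rewrite /psi; case: ifP.
have ndpsi r : nondecreasing_seq (psi ^~ r).
  apply/nondecreasing_seqP => m; rewrite /psi; case: ifP => // _.
  by apply: nphi; rewrite le_min !ge_min lexx orbT andbT dyadic_ceilS.
apply: (weighted_norm_fatou (F := fun m => psi m \o rho)) => //.
- by move=> m; exact: measurable_antitone (npsi m).
- by move=> m x; exact: psi_ge0.
- by move=> x; exact: ndpsi.
- move=> x; have := ereal_nondecreasing_cvgn (ndpsi (rho x)).
  rewrite [X in _ --> X](_ : _ = (\1_[set z | (rho z < t)%R] x)%:E * phi (rho x))//.
  rewrite indic_boolE.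
  apply/eqP; rewrite eq_le; have [xt|xt] := ltP (rho x) t.
    rewrite mul1e; apply/andP; split.
      apply: ge_ereal_sup => _ [m _ <-]; rewrite /psi xt; apply: nphi.
      by rewrite le_min (ltW xt) ltW ?dyadic_ceil_gt.
    (* Right-continuity enters here: each [r' > rho x] lies beyond the dyadic ceiling of [rho x] for
       some [m], so [phi r'] is below the supremum. *)
    apply: rphi => r' xr'; have [m mr'] := dyadic_ceil_near t0 (rho_ge0 x) xr'.
    apply: (@le_trans _ _ (psi m (rho x))).
      by rewrite /psi xt; apply: nphi; rewrite ge_min mr'.
    by apply: ereal_sup_ubound; exists m.
  rewrite mul0e; apply/andP; split.
    by apply: ge_ereal_sup => _ [m _ <-]; rewrite /psi ltNge xt.
  by apply: (le_trans (psi_ge0 0%N (rho x))); apply: ereal_sup_ubound; exists 0%N.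
(* The grid runs downwards from [s 0 = t] in steps of [t / 2 ^ m]. Its last index is [2 ^ m - 1],
   since the next point would be 0. *)
- move=> m; pose s i := (t * (2 ^+ m - i%:R) / 2 ^+ m)%R.
  have e0 : (0 < 2 ^+ m :> R)%R by rewrite exprn_gt0.
  have em1 : (0 < 2 ^ m)%N by rewrite expn_gt0.
  apply: (H (2 ^ m).-1 s).
  + by rewrite /s subr0 mulfK// gt_eqF.
  + move=> i iK; rewrite /s divr_gt0// mulr_gt0// subr_gt0 -natrX ltr_nat.
    by rewrite (leq_ltn_trans iK)// prednK.
  + move=> i j ij; rewrite /s ler_pM2r ?invr_gt0// ler_pM2l// lerD2l lerN2.
    by rewrite ler_nat.
  + exact: measurable_antitone (npsi m).
  + by move=> x; exact: psi_ge0.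
  + move=> x; rewrite /= /psi; case: ltP => xt; last by left.
    have nt : (Num.truncn (rho x / t * 2 ^+ m) < 2 ^ m)%N.
      rewrite truncn_lt_nat; last first.
        by apply: mulr_ge0 (ltW e0); apply: divr_ge0 (ltW t0).
      by rewrite natrX gtr_pMl// ltr_pdivrMr// mul1r.
    (* The ceiling has index [truncn + 1] counted upwards from 0, hence [2 ^ m - 1 - truncn] counted
       downwards from [t]. *)
    have sE : s ((2 ^ m).-1 - Num.truncn (rho x / t * 2 ^+ m))%N = tau m (rho x).
      rewrite /s /tau /dyadic_ceil; congr (_ * _ / _)%R.
      rewrite natrB; last by rewrite -ltnS (prednK em1).
      by rewrite -subn1 natrB// natrX -natr1; ring.
    right; exists ((2 ^ m).-1 - Num.truncn (rho x / t * 2 ^+ m))%N; split.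
    * exact: leq_subr.
    * by rewrite sE dyadic_ceil_gt.
    * rewrite sE (min_idPl _)// /tau /dyadic_ceil ler_pdivrMr// ler_pM2l//.
      by rewrite -[leRHS]natrX ler_nat.
Qed.

End radial.

(** * The dual tail and Hoelder's inequality *)

Lemma measurable_inve d (T : measurableType d) (R : realType) (v : T -> \bar R) :
  measurable_fun setT v -> (forall x, 0 < v x) ->
  measurable_fun setT (fun x => (v x)^-1).
Proof.
move=> mv v0 mD; apply: (measurability _ (ErealGenCInfty.measurableE R)) => //.
move=> _ [_ [r ->] <-]; rewrite setTI.
have [r0|r0] := leP 0%R r.
  rewrite (_ : _ @^-1` _ = v @^-1` `]-oo, r%:E^-1]).
    by rewrite -[X in measurable X]setTI; apply: mv => //; exact: emeasurable_itv.
  apply/seteqP; split => x /=; rewrite !in_itv/= andbT inve_pge ?inE//; exact: ltW.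
rewrite (_ : _ @^-1` _ = setT)//; apply/seteqP; split => x //= _.
rewrite in_itv/= andbT; apply: (@le_trans _ _ 0); first by rewrite lee_fin ltW.
by rewrite inve_ge0 ltW.
Qed.

Lemma poweRVK (R : realType) (x : \bar R) (a : R) : (0 < a)%R -> 0 <= x ->
  (x `^ a) `^ a^-1 = x.
Proof. by move=> a0 x0; rewrite -poweRrM mulfV ?gt_eqF// poweRe1. Qed.

Lemma lee_poweR (R : realType) (x y : \bar R) (a : R) : (0 <= a)%R ->
  0 <= x -> x <= y -> x `^ a <= y `^ a.
Proof.
move=> a0 x0 xy; apply: gt0_ler_poweR => //; rewrite in_itv/= leey andbT//.
exact: le_trans xy.
Qed.

Lemma hoelder_conjugateE (R : realType) (p : R) : (1 < p)%R ->
  hoelder_conjugate p%:E = (p / (p - 1))%:E.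
Proof.
move=> p1; rewrite /hoelder_conjugate/= eqe gt_eqF ?(lt_trans _ p1)//.
by rewrite -EFinD inver subr_eq0 gt_eqF.
Qed.

Section weighted_tail.
Context d (T : measurableType d) (R : realType).
Variable mu : {measure set T -> \bar R}.
Implicit Types (v f : T -> \bar R) (S : set T) (p : R).

(* [dual_tail] with the exterior of a ball replaced by an arbitrary set. *)
Definition tail_norm p v S : \bar R :=
  Lnorm mu (hoelder_conjugate p%:E) (fun y => (\1_S y)%:E * (v y)^-1).

Lemma tail_norm_ge0 p v S : 0 <= tail_norm p v S.
Proof. exact: Lnorm_ge0. Qed.

Lemma tail_normE p v S : (1 < p)%R -> is_weight mu v -> measurable S ->
  tail_norm p v S =
  (\int[mu]_(y in S) (v y)^-1 `^ (p / (p - 1))) `^ (p / (p - 1))^-1.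
Proof.
move=> p1 [mv v0 _] mS; rewrite /tail_norm hoelder_conjugateE// unlock.
have q0 : (p / (p - 1) != 0)%R.
  by rewrite gt_eqF// divr_gt0 ?subr_gt0// (lt_trans _ p1).
congr (_ `^ _); rewrite [RHS]integral_mkcond; apply: eq_integral => y _.
rewrite patchE indicE; case: ifP => yS; last by rewrite mul0e abse0 poweR0r.
by rewrite mul1e gee0_abs// inve_ge0 ltW.
Qed.

(** The definition of the norm at exponent [+oo] branches on [0 < mu setT], hence that
    hypothesis. *)
Lemma tail_norm1E v S : is_weight mu v -> 0 < mu setT ->
  tail_norm 1 v S = ess_sup mu (fun y => (\1_S y)%:E * (v y)^-1).
Proof.
move=> [mv v0 _] mu0; rewrite /tail_norm hoelder_conjugate1 unlock mu0.
congr (ess_sup _ _); apply/funext => y /=; rewrite gee0_abs//.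
by rewrite mule_ge0// inve_ge0 ltW.
Qed.

Lemma tail_norm_subset p v S S' : (1 <= p)%R -> is_weight mu v ->
  0 < mu setT -> measurable S -> measurable S' -> S `<=` S' ->
  tail_norm p v S <= tail_norm p v S'.
Proof.
rewrite le_eqVlt => /predU1P[<-|p1] wv mu0 mS mS' SS'; have [mv v0 _] := wv.
  rewrite !tail_norm1E//; apply: le_ess_sup; apply: aeW => y.
  apply: lee_wpmul2r; first by rewrite inve_ge0 ltW.
  by rewrite !indicE lee_fin ler_nat;
  case: (boolP (y \in S)) => // /set_mem/SS'/mem_set ->.
have q0 : (0 <= (p / (p - 1))^-1)%R.
  by rewrite invr_ge0 divr_ge0 ?subr_ge0 ?(ltW p1)// (le_trans _ (ltW p1)).
rewrite !tail_normE//; apply: lee_poweR => //.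
  by apply: integral_ge0 => y _; exact: poweR_ge0.
apply: ge0_subset_integral => //.
- apply: measurable_funTS; apply: (measurableT_comp (measurable_poweR _)).
  exact: measurable_inve.
- by move=> y _; exact: poweR_ge0.
Qed.

(** For [p > 1] the power [p'] of the tail is an integral, hence additive. For [p = 1] it is an
    essential supremum, and the later arguments use its monotonicity instead. *)
Lemma tail_norm_setU p v S S' : (1 < p)%R -> is_weight mu v ->
  measurable S -> measurable S' -> [disjoint S & S'] ->
  tail_norm p v (S `|` S') `^ (p / (p - 1)) =
  tail_norm p v S `^ (p / (p - 1)) + tail_norm p v S' `^ (p / (p - 1)).
Proof.
move=> p1 wv mS mS' SS'; have [mv v0 _] := wv.
have q0 : (0 < p / (p - 1))%R by rewrite divr_gt0 ?subr_gt0// (lt_trans _ p1).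
rewrite !tail_normE//; last exact: measurableU.
have E (D : set T) : ((\int[mu]_(y in D) (v y)^-1 `^ (p / (p - 1)))
    `^ (p / (p - 1))^-1) `^ (p / (p - 1)) = \int[mu]_(y in D) (v y)^-1 `^ (p / (p - 1)).
  rewrite -poweRrM mulVf ?gt_eqF// poweRe1//.
  by apply: integral_ge0 => y _; exact: poweR_ge0.
rewrite !E ge0_integral_setU//; last by move=> y _; exact: poweR_ge0.
apply: measurable_funTS; apply: (measurableT_comp (measurable_poweR _)).
exact: measurable_inve.
Qed.

(** Hoelder's inequality for [f = (f v) v^-1]. This factorization holds only where [v] is finite,
    that is, almost everywhere. *)
Lemma tail_norm_hoelder p v f S : (1 <= p)%R -> is_weight mu v -> 0 < mu setT ->
  measurable_fun setT f -> (forall y, 0 <= f y) -> measurable S ->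
  \int[mu]_(y in S) (f y * v y) `^ p < +oo ->
  \int[mu]_(y in S) f y <=
  (\int[mu]_(y in S) (f y * v y) `^ p) `^ p^-1 * tail_norm p v S.
Proof.
rewrite le_eqVlt => /predU1P[<-|p1] wv mu0 mf f0 mS; have [mv v0 vfin] := wv.
  have fv0 y : 0 <= f y * v y by rewrite mule_ge0// ltW.
  under eq_integral do rewrite poweRe1//.
  rewrite invr1 poweRe1 ?integral_ge0// tail_norm1E// muleC => _.
  set c := ess_sup _ _.
  have c0 : 0 <= c.
    by rewrite /c -tail_norm1E// tail_norm_ge0.
  have mfv : measurable_fun S (fun y => f y * v y).
    by apply: measurable_funTS; exact: emeasurable_funM.
  rewrite -ge0_integralZl//; apply: ae_ge0_le_integral => //.
  - exact: measurable_funTS.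
  - by move=> y _; rewrite mule_ge0.
  - exact: measurable_funeM.
  - have : {ae mu, forall y, (\1_S y)%:E * (v y)^-1 <= c} by exact/ess_supP.
    apply: filterS2 vfin => y vy + Sy; rewrite indicE mem_set// mul1e => vc.
    rewrite [leLHS](_ : _ = (v y)^-1 * (f y * v y)).
      exact: lee_wpmul2r.
    have vr : v y \is a fin_num by rewrite ge0_fin_numE// ltW.
    by rewrite muleCA (muleC (v y)^-1) divee ?mule1// gt_eqF.
have p0 : (0 < p)%R by exact: lt_trans p1.
have q0 : (0 < p / (p - 1))%R by rewrite divr_gt0 ?subr_gt0.
have pq : (p^-1 + (p / (p - 1))^-1 = 1)%R.
  have p1' : (0 < p - 1)%R by rewrite subr_gt0.
  by field; rewrite !gt_eqF.
have fv0 y : 0 <= f y * v y by rewrite mule_ge0// ltW.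
have mfv : measurable_fun setT (fun y => f y * v y) by exact: emeasurable_funM.
have mvV := measurable_inve mv v0.
(* Hoelder's inequality is applied to real-valued versions of [f v] and [v^-1], cut off outside
   [S]. *)
pose F y := (fine (f y * v y) * \1_S y)%R.
pose G y := (fine (v y)^-1 * \1_S y)%R.
have mF : measurable_fun setT F.
  by apply: measurable_funM; [exact: measurableT_comp|exact: measurable_indic].
have mG : measurable_fun setT G.
  by apply: measurable_funM; [exact: measurableT_comp|exact: measurable_indic].
move=> Ioo; have := hoelder mu mF mG p0 q0 pq.
rewrite Lnorm1 tail_normE// => H.
(* Passing to [fine] can only lower the norms, since it sends [+oo] to 0. *)
have le_pow (h : T -> \bar R) (a : R) : (0 < a)%R -> (forall y, 0 <= h y) ->
    measurable_fun setT h ->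
    Lnorm mu a%:E (EFin \o (fun y => fine (h y) * \1_S y)%R) <=
    (\int[mu]_(y in S) h y `^ a) `^ a^-1.
  move=> a0 h0 mh; rewrite unlock; apply: lee_poweR.
  - by rewrite invr_ge0 ltW.
  - by apply: integral_ge0 => y _; exact: poweR_ge0.
  rewrite [leRHS]integral_mkcond; apply: ge0_le_integral => //.
  - by move=> y _; exact: poweR_ge0.
  - apply: (measurableT_comp (measurable_poweR _)).
    apply: measurableT_comp => //; apply/measurable_EFinP.
    by apply: measurable_funM; [exact: measurableT_comp|exact: measurable_indic].
  - apply/(measurable_restrictT _ mS).1; apply: measurable_funTS.
    exact: (measurableT_comp (measurable_poweR _)).
  - move=> y _; rewrite patchE/= indicE; case: ifP => _; last first.
      by rewrite mulr0 normr0 powR0// gt_eqF.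
    rewrite mulr1 ger0_norm ?fine_ge0//.
    move: (h0 y); case: (h y) => //= _; rewrite powR0 ?gt_eqF//.
    by rewrite leey.
apply: le_trans (le_trans H _); last first.
  apply: lee_pmul; rewrite ?Lnorm_ge0//; apply: le_pow => // y.
  by rewrite inve_ge0 ltW.
rewrite [leLHS]integral_mkcond; apply: ae_ge0_le_integral => //.
- by move=> y _; rewrite patchE; case: ifP.
- by apply/(measurable_restrictT _ mS).1; exact: measurable_funTS.
- apply: measurableT_comp => //; apply/measurable_EFinP.
  exact: measurable_funM.
(* The finite integral makes [f v] finite a.e. on [S], so that [f = F G] a.e. there and nothing is
   lost on the left-hand side. *)
have fvfin : {ae mu, forall y, S y -> (f y * v y) `^ p \is a fin_num}.
  apply: (@integrable_ae _ _ _ mu S mS); apply/integrableP; split.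
    by apply: measurable_funTS; exact: (measurableT_comp (measurable_poweR _)).
  by under eq_integral do rewrite gee0_abs ?poweR_ge0//.
apply: filterS2 vfin fvfin => y vy fvy _; rewrite patchE /F /G/= indicE.
case: ifPn => [/set_mem /fvy {}fvy|_]; last by rewrite lee_fin.
have {}fvy : f y * v y \is a fin_num.
  rewrite ge0_fin_numE// (@lty_poweRy _ _ p) ?gt_eqF//.
  by rewrite ltey_eq fvy.
have vr : v y \is a fin_num by rewrite ge0_fin_numE// ltW.
rewrite !mulr1 ger0_norm ?mulr_ge0 ?fine_ge0 ?inve_ge0 ?(ltW (v0 y))//.
rewrite EFinM fineK// fineK; last first.
  by rewrite ge0_fin_numE ?inve_ge0 ?(ltW (v0 y))// ltey inve_eqy gt_eqF.
by rewrite -muleA divee ?mule1// gt_eqF.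
Qed.

End weighted_tail.

(** * Exteriors, shells, and right-continuity of the tails in the radius *)

Section radial_tail.
Context d (T : measurableType d) (R : realType).
Variables (mu : {measure set T -> \bar R}) (rho : T -> R).
Hypothesis mrho : measurable_fun setT rho.
Implicit Types (v f : T -> \bar R) (r s : R).

Lemma measurable_outer r : measurable [set y | (r < rho y)%R].
Proof.
rewrite (_ : mkset _ = rho @^-1` `]r, +oo[).
  by rewrite -[X in measurable X]setTI; exact: mrho.
by apply/seteqP; split => y /=; rewrite in_itv/= andbT.
Qed.

Lemma measurable_inner r : measurable [set y | (rho y < r)%R].
Proof.
rewrite (_ : mkset _ = rho @^-1` `]-oo, r[).
  by rewrite -[X in measurable X]setTI; exact: mrho.
by apply/seteqP; split => y /=; rewrite in_itv/=.
Qed.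

Lemma measurable_shell r s : measurable [set y | (r < rho y <= s)%R].
Proof.
rewrite (_ : mkset _ = rho @^-1` `]r, s]).
  by rewrite -[X in measurable X]setTI; exact: mrho.
by apply/seteqP; split => y /=; rewrite in_itv/=.
Qed.

Lemma outer_shell r s : (r <= s)%R ->
  [set y | (r < rho y)%R] = [set y | (r < rho y <= s)%R] `|` [set y | (s < rho y)%R].
Proof.
move=> rs; apply/seteqP; split => y /=.
  by move=> ry; have [ys|ys] := leP (rho y) s; [left; rewrite ry|right].
by case => [/andP[]//|]; exact: le_lt_trans.
Qed.

Lemma disj_shell r s :
  [disjoint [set y | (r < rho y <= s)%R] & [set y | (s < rho y)%R]].
Proof.
apply/disj_set2P; apply/seteqP; split => // y [] /= /andP[_ ys].
by rewrite ltNge ys.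
Qed.

Lemma integral_outer_shell f r s : measurable_fun setT f -> (forall y, 0 <= f y) ->
  (r <= s)%R ->
  \int[mu]_(y in [set y | (r < rho y)%R]) f y =
  \int[mu]_(y in [set y | (r < rho y <= s)%R]) f y +
  \int[mu]_(y in [set y | (s < rho y)%R]) f y.
Proof.
move=> mf f0 rs; rewrite (outer_shell rs) ge0_integral_setU//.
- exact: measurable_shell.
- exact: measurable_outer.
- exact: measurable_funTS.
- exact: disj_shell.
Qed.

Lemma integral_outer_le f r s : measurable_fun setT f -> (forall y, 0 <= f y) ->
  (r <= s)%R ->
  \int[mu]_(y in [set y | (s < rho y)%R]) f y <=
  \int[mu]_(y in [set y | (r < rho y)%R]) f y.
Proof.
by move=> mf f0 rs; rewrite (integral_outer_shell mf f0 rs) leeDr ?integral_ge0.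
Qed.

(** The strict inequality lets the exterior be exhausted from slightly larger radii;
    right-continuity of all tails comes from this. *)
Lemma outer_bigcup r :
  [set y | (r < rho y)%R] = \bigcup_k [set y | (r + k.+1%:R^-1 < rho y)%R].
Proof.
apply/seteqP; split => y /= => [ry|[k _ /=]]; last first.
  by apply: le_lt_trans; rewrite lerDl invr_ge0.
have /ltr_add_invr[k kr] := ry.
by exists k.
Qed.

Lemma nd_outer r : nondecreasing_seq (fun k => [set y | (r + k.+1%:R^-1 < rho y)%R]).
Proof.
move=> i j ij; apply/subsetPset => y /=; apply: le_lt_trans.
by rewrite lerD2l lef_pV2 ?posrE// ler_nat.
Qed.

Lemma integral_outer_right f r z : measurable_fun setT f -> (forall y, 0 <= f y) ->
  (forall r', (r < r')%R -> \int[mu]_(y in [set y | (r' < rho y)%R]) f y <= z) ->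
  \int[mu]_(y in [set y | (r < rho y)%R]) f y <= z.
Proof.
move=> mf f0 fz; rewrite outer_bigcup.
have := @ge0_nondecreasing_set_cvg_integral _ _ _ _ f mu (nd_outer r).
move=> /(_ (fun=> measurable_outer _) (fun=> measurable_funTS mf) (fun _ _ _ => f0 _)).
by move/cvgn_le; apply => k; apply: fz; rewrite ltrDl invr_gt0.
Qed.

Variable p : R.
Hypothesis p_ge1 : (1 <= p)%R.
Hypothesis mu_gt0 : 0 < mu setT.

Let V v r := tail_norm mu p v [set y | (r < rho y)%R].

Let mg v : is_weight mu v ->
  measurable_fun setT (fun y => (v y)^-1 `^ (p / (p - 1))).
Proof.
move=> [mv v0 _]; apply: (measurableT_comp (measurable_poweR _)).
exact: measurable_inve.
Qed.

Lemma tail_norm_outer_le v r s : is_weight mu v -> (r <= s)%R -> V v s <= V v r.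
Proof.
move=> wv rs; apply: tail_norm_subset => //; try exact: measurable_outer.
by move=> y /=; exact: le_lt_trans.
Qed.

(** For [p = 1], the a.e. bounds at the countably many radii [r + 1 / (k + 1)] hold simultaneously.
    For [p > 1], this is right-continuity of the integral of [v ^ (- p')]. *)
Lemma tail_norm_outer_right v r z : is_weight mu v ->
  (forall r', (r < r')%R -> V v r' <= z) -> V v r <= z.
Proof.
move=> wv; rewrite /V; move: p_ge1; rewrite le_eqVlt => /predU1P[<-|p1] Vz.
  have [_ v0 _] := wv.
  rewrite tail_norm1E//; apply/ess_supP.
  have : {ae mu, forall y, forall k,
      (\1_[set y | (r + k.+1%:R^-1 < rho y)%R] y)%:E * (v y)^-1 <= z}.
    apply: ae_foralln => k; apply/ess_supP; rewrite -tail_norm1E//.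
    by apply: Vz; rewrite ltrDl invr_gt0.
  apply: filterS => y yz; rewrite indic_boolE; case: ltP => [ry|_]; last first.
    by apply: le_trans (yz 0%N); rewrite mul0e mule_ge0// inve_ge0 ltW.
  move: ry; rewrite -/([set y | (r < rho y)%R] y) outer_bigcup => -[k _ /= rk].
  by have := yz k; rewrite indic_boolE rk.
have z0 : 0 <= z by apply: le_trans (Vz (r + 1)%R _); rewrite ?ltrDl// tail_norm_ge0.
have q0 : (0 < p / (p - 1))%R by rewrite divr_gt0 ?subr_gt0// (lt_trans _ p1).
have g0 y : 0 <= (v y)^-1 `^ (p / (p - 1)) by exact: poweR_ge0.
rewrite tail_normE//; last exact: measurable_outer.
rewrite -[leRHS](poweRVK q0)//; apply: lee_poweR.
- by rewrite invr_ge0 ltW.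
- exact: integral_ge0.
apply: integral_outer_right => //; first exact: mg.
move=> r' /Vz; rewrite tail_normE//; last exact: measurable_outer.
move=> H; rewrite -[leLHS](poweRVK (a := (p / (p - 1))^-1)) ?invr_gt0//;
  last exact: integral_ge0.
by rewrite invrK; apply: lee_poweR => //; [exact: ltW|exact: poweR_ge0].
Qed.

(** A vanishing tail forces [v^-1 = 0], that is [v = +oo], a.e. on [S], against the a.e. finiteness
    of a weight. *)
Lemma tail_norm_gt0 v (S : set T) : is_weight mu v -> measurable S -> 0 < mu S ->
  0 < tail_norm mu p v S.
Proof.
move=> wv mS S0; have [mv v0 vfin] := wv.
rewrite lt_neqAle tail_norm_ge0 andbT; apply/eqP => /esym.
have m1 : measurable_fun setT (fun y => (\1_S y)%:E * (v y)^-1).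
  apply: emeasurable_funM; last exact: measurable_inve.
  by apply/measurable_EFinP; exact: measurable_indic.
move/(Lnorm_eq0_eq0 m1) => H.
have {}H := H (lt_le_trans lte01 (hoelder_conj_ge1 _)).
have {}H := H p_ge1.
suff muS : mu S = 0 by rewrite muS ltxx in S0.
apply: (ae_measure0 (P := fun y => v y < +oo /\ (\1_S y)%:E * (v y)^-1 = 0)) => //.
  by apply: filterS2 vfin H => y vy /(_ I).
move=> y Sy [vy]; rewrite indicE mem_set// mul1e => /eqP.
by rewrite inve_eq0 => /eqP vyoo; rewrite vyoo in vy.
Qed.

End radial_tail.

(** * Sufficiency *)

Section upper_bound.
Context d (T : measurableType d) (R : realType).
Variables (mu : {sigma_finite_measure set T -> \bar R}) (p gamma : R) (v f : T -> \bar R).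
Hypotheses (p_ge1 : (1 <= p)%R) (gamma01 : (0 < gamma < 1)%R).
Hypotheses (v_weight : is_weight mu v) (mu_gt0 : 0 < mu setT).
Hypotheses (mf : measurable_fun setT f) (f_ge0 : forall y, 0 <= f y).

Let gamma_gt0 : (0 < gamma)%R. Proof. by case/andP: gamma01. Qed.
Let gamma_lt1 : (0 < 1 - gamma)%R. Proof. by case/andP: gamma01; rewrite subr_gt0. Qed.
Let p_gt0 : (0 < p)%R. Proof. exact: lt_le_trans p_ge1. Qed.
Let fv_ge0 y : 0 <= (f y * v y) `^ p. Proof. exact: poweR_ge0. Qed.
Let mfv : measurable_fun setT (fun y => (f y * v y) `^ p).
Proof.
have [mv _ _] := v_weight.
by apply: (measurableT_comp (measurable_poweR _)); exact: emeasurable_funM.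
Qed.

(** Induction step from the exterior [S'] to [S'] enlarged by the shell [S]: Hoelder's inequality on
    [S], the bound already known on [S'], and [upper_factor_step]. *)
Lemma integral_hardy_step (S S' : set T) (A : R) :
  measurable S -> measurable S' -> [disjoint S & S'] ->
  0 < tail_norm mu p v (S `|` S') < +oo ->
  \int[mu]_(y in S) (f y * v y) `^ p < +oo -> (0 <= A)%R ->
  \int[mu]_(y in S') f y <=
    (upper_factor gamma p * A `^ p^-1 *
     fine (tail_norm mu p v S') `^ (1 - gamma))%R%:E ->
  \int[mu]_(y in S `|` S') f y <=
    (upper_factor gamma p * (A + fine (\int[mu]_(y in S) (f y * v y) `^ p) *
       fine (tail_norm mu p v (S `|` S')) `^ (gamma * p)) `^ p^-1 *
     fine (tail_norm mu p v (S `|` S')) `^ (1 - gamma))%R%:E.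
Proof.
move=> mS mS' SS' /andP[U0 Uoo] Ioo A0 HS'.
have mU : measurable (S `|` S') by exact: measurableU.
have leS := tail_norm_subset p_ge1 v_weight mu_gt0 mS mU (@subsetUl _ S S').
have leS' := tail_norm_subset p_ge1 v_weight mu_gt0 mS' mU (@subsetUr _ S S').
have U_fin : tail_norm mu p v (S `|` S') \is a fin_num.
  by rewrite ge0_fin_numE// ltW.
have S_fin : tail_norm mu p v S \is a fin_num.
  by rewrite ge0_fin_numE ?tail_norm_ge0// (le_lt_trans leS).
have S'_fin : tail_norm mu p v S' \is a fin_num.
  by rewrite ge0_fin_numE ?tail_norm_ge0// (le_lt_trans leS').
have I_fin : \int[mu]_(y in S) (f y * v y) `^ p \is a fin_num.
  by rewrite ge0_fin_numE// integral_ge0.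
have HS := tail_norm_hoelder p_ge1 v_weight mu_gt0 mf f_ge0 mS Ioo.
rewrite ge0_integral_setU//; last exact: measurable_funTS.
apply: (le_trans (leeD HS HS')).
rewrite -(fineK I_fin) -(fineK S_fin) poweR_EFin -EFinM -EFinD lee_fin.
set alpha := fine (\int[mu]_(y in S) _).
have alpha0 : (0 <= alpha)%R by rewrite fine_ge0// integral_ge0.
set a := fine (tail_norm mu p v (S `|` S')).
set b := fine (tail_norm mu p v S').
set c := fine (tail_norm mu p v S).
have a0 : (0 < a)%R by rewrite fine_gt0// U0.
have b0 : (0 <= b)%R by rewrite fine_ge0// tail_norm_ge0.
have c0 : (0 <= c)%R by rewrite fine_ge0// tail_norm_ge0.
have ca : (c <= a)%R by rewrite fine_le.
have ba : (b <= a)%R by rewrite fine_le.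
rewrite addrC; move: (p_ge1); rewrite le_eqVlt => /predU1P[p1|p1]; last first.
  apply: upper_factor_step => //.
  have := tail_norm_setU p1 v_weight mS mS' SS'.
  rewrite -{1}(fineK U_fin) -{1}(fineK S_fin) -{1}(fineK S'_fin) !poweR_EFin.
  by rewrite -EFinD => -[].
(* For [p = 1] the constant is 1, and [b <= a], [c <= a] and [a = a ^ gamma a ^ (1 - gamma)]
   suffice. *)
rewrite -p1 upper_factor1// invr1 !mul1r mulr1 !powRr1//; last first.
  by rewrite addr_ge0// mulr_ge0// powR_ge0.
rewrite mulrDl -mulrA -powRD; last by rewrite addrC subrK oner_eq0.
rewrite (addrC gamma) subrK powRr1 ?(ltW a0)//; apply: lerD.
  apply: ler_wpM2l => //.
  by apply: ge0_ler_powR; rewrite ?nnegrE ?(ltW gamma_lt1) ?(ltW a0).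
exact: ler_wpM2l.
Qed.

Variable rho : T -> R.
Hypotheses (mrho : measurable_fun setT rho) (rho_ge0 : forall x, (0 <= rho x)%R).
Hypothesis outer_gt0 : forall r, (0 < r)%R -> 0 < mu [set y | (r < rho y)%R].

Local Notation V r := (tail_norm mu p v [set y | (r < rho y)%R]).
Local Notation H r := (\int[mu]_(y in [set y | (r < rho y)%R]) f y).

Hypothesis V_fin : forall r, (0 < r)%R -> V r < +oo.
Hypothesis fv_fin : \int[mu]_y (f y * v y) `^ p < +oo.

Let V_gt0 r : (0 < r)%R -> 0 < V r < +oo.
Proof.
move=> r0; rewrite V_fin// andbT; apply: tail_norm_gt0 => //; last exact: outer_gt0.
exact: measurable_outer.
Qed.

(** Index 0 stands for the whole exterior of [s 0], so that the masses up to index [K] add up to the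
    exterior of [s K]. *)
Definition shell_mass (s : nat -> R) (k : nat) : R :=
  if k is k'.+1
  then fine (\int[mu]_(y in [set y | (s k < rho y <= s k')%R]) (f y * v y) `^ p)
  else fine (\int[mu]_(y in [set y | (s 0%N < rho y)%R]) (f y * v y) `^ p).

Let int_fin S : measurable S -> \int[mu]_(y in S) (f y * v y) `^ p < +oo.
Proof.
move=> mS; apply: le_lt_trans fv_fin; apply: ge0_subset_integral => //.
Qed.

Lemma shell_mass_ge0 s k : (0 <= shell_mass s k)%R.
Proof. by case: k => [|k]; rewrite fine_ge0// integral_ge0. Qed.

Lemma sum_shell_mass s K : {homo s : i j / (i <= j)%N >-> (j <= i)%R} ->
  (\sum_(0 <= k < K.+1) shell_mass s k)%:E =
  \int[mu]_(y in [set y | (s K < rho y)%R]) (f y * v y) `^ p.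
Proof.
move=> ns; elim: K => [|K IH].
  rewrite big_nat1 /= fineK// ge0_fin_numE ?integral_ge0//.
  by apply: int_fin; exact: measurable_outer.
rewrite big_nat_recr//= EFinD IH (integral_outer_shell mu mrho mfv _ (ns K K.+1 _))//.
rewrite fineK 1?addeC// ge0_fin_numE ?integral_ge0//.
by apply: int_fin; exact: measurable_shell.
Qed.

Lemma hardy_grid_le s K i : (i <= K)%N -> (forall j, (j <= K)%N -> (0 < s j)%R) ->
  {homo s : i j / (i <= j)%N >-> (j <= i)%R} ->
  H (s i) <=
  (upper_factor gamma p *
   (\sum_(0 <= k < i.+1) shell_mass s k * fine (V (s k)) `^ (gamma * p)) `^ p^-1 *
   fine (V (s i)) `^ (1 - gamma))%R%:E.
Proof.
move=> + s0 ns; elim: i => [|i IH] iK.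
  (* The base case is the same step, with the empty set as inner term [S'] and [A = 0]. *)
  rewrite big_nat1 -[X in (X `^ _)%R]add0r.
  have E := setU0 [set y | (s 0%N < rho y)%R].
  rewrite -{1}E -[in X in _ <= (_ * X)%R%:E]E -[in X in _ <= (_ * X * _)%R%:E]E.
  rewrite /shell_mass; apply: integral_hardy_step => //.
  - exact: measurable_outer.
  - by apply/disj_set2P; rewrite setI0.
  - by rewrite E; exact: V_gt0 (s0 _ _).
  - by apply: int_fin; exact: measurable_outer.
  - rewrite integral_set0 lee_fin !mulr_ge0 ?powR_ge0//.
    by rewrite ltW// upper_factor_gt0.
have ii : (s i.+1 <= s i)%R by exact: ns.
have E := outer_shell rho ii.
rewrite big_nat_recr//= E; apply: integral_hardy_step => //.
- exact: measurable_shell.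
- exact: measurable_outer.
- exact: disj_shell.
- by rewrite -E; exact: V_gt0 (s0 _ _).
- by apply: int_fin; exact: measurable_shell.
- apply: sumr_ge0 => k _; apply: mulr_ge0; [exact: shell_mass_ge0|exact: powR_ge0].
- by apply: IH; exact: ltnW.
Qed.

End upper_bound.

Section weighted_norm_theory.
Context d (T : measurableType d) (R : realType).
Variables (mu : {sigma_finite_measure set T -> \bar R}) (N : (T -> R) -> \bar R).
Variable w : T -> \bar R.
Hypotheses (N_BFS : is_BFS mu N) (w_weight : is_weight mu w).
Local Notation Nw := (weighted_norm mu N w).
Implicit Types F G : T -> \bar R.

Lemma weighted_norm_ge0 F : measurable_fun setT F -> 0 <= Nw F.
Proof.
have [mw _ _] := w_weight.
by move=> mF; apply: (BFS_norm_ge0 N_BFS); exact: emeasurable_funM.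
Qed.

Lemma weighted_norm_le F G : measurable_fun setT F -> measurable_fun setT G ->
  (forall x, 0 <= F x <= G x) -> Nw F <= Nw G.
Proof.
have [mw w0 _] := w_weight => mF mG FG.
apply: (BFS_norm_le N_BFS); try exact: emeasurable_funM.
move=> x; have /andP[F0 FGx] := FG x; rewrite mule_ge0 ?(ltW (w0 x))//=.
by apply: lee_wpmul2r; first exact: ltW.
Qed.

Lemma weighted_normZ (a : R) F : (0 <= a)%R -> measurable_fun setT F ->
  (forall x, 0 <= F x) -> Nw (fun x => a%:E * F x) = a%:E * Nw F.
Proof.
have [mw w0 _] := w_weight => a0 mF F0.
rewrite /weighted_norm -(BFS_normZ N_BFS a0); last first.
- by move=> x; rewrite mule_ge0// ltW.
- exact: emeasurable_funM.
by congr BFS_norm; apply/funext => x; rewrite muleA.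
Qed.

Lemma weighted_norm_gt0 F (A : set T) : measurable A -> 0 < mu A ->
  measurable_fun setT F -> (forall x, 0 <= F x) -> (forall x, A x -> 0 < F x) ->
  0 < Nw F.
Proof.
have [mw w0 _] := w_weight => mA A0 mF F0 FA.
apply: (BFS_norm_gt0 N_BFS mA A0).
- exact: emeasurable_funM.
- by move=> x; rewrite mule_ge0// ltW.
- by move=> x /FA Fx; rewrite mule_gt0.
Qed.

End weighted_norm_theory.

Section hardy_upper.
Context d (T : measurableType d) (R : realType).
Variables (mu : {sigma_finite_measure set T -> \bar R}) (N : (T -> R) -> \bar R).
Variables (p M gamma : R) (v w : T -> \bar R) (rho : T -> R).
Hypotheses (p_ge1 : (1 <= p)%R) (gamma01 : (0 < gamma < 1)%R).
Hypotheses (v_weight : is_weight mu v) (w_weight : is_weight mu w).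
Hypotheses (N_BFS : is_BFS mu N) (M_gt0 : (0 < M)%R) (w_convex : p_convex mu N w p M).
Hypotheses (mrho : measurable_fun setT rho) (rho_ge0 : forall x, (0 <= rho x)%R).
Hypothesis outer_gt0 : forall r, (0 < r)%R -> 0 < mu [set y | (r < rho y)%R].
Hypothesis inner_gt0 : forall r, (0 < r)%R -> 0 < mu [set y | (rho y < r)%R].

Local Notation Nw := (weighted_norm mu N w).
Local Notation V r := (tail_norm mu p v [set y | (r < rho y)%R]).

Definition hardy_profile (r : R) : T -> \bar R :=
  fun x => (\1_[set z | (rho z < r)%R] x)%:E * (V (rho x)) `^ (1 - gamma)%R.

Let gamma_gt0 : (0 < gamma)%R. Proof. by case/andP: gamma01. Qed.
Let gamma_lt1 : (0 < 1 - gamma)%R. Proof. by case/andP: gamma01; rewrite subr_gt0. Qed.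
Let p_gt0 : (0 < p)%R. Proof. exact: lt_le_trans p_ge1. Qed.

Let muT_gt0 : 0 < mu setT.
Proof.
apply: lt_le_trans (outer_gt0 ltr01) _.
by apply: le_measure; rewrite ?inE//; exact: measurable_outer.
Qed.

Let V_anti r s : (r <= s)%R -> V s <= V r.
Proof. exact: tail_norm_outer_le. Qed.

Lemma measurable_indic_inner r :
  measurable_fun setT (fun x => (\1_[set z | (rho z < r)%R] x)%:E : \bar R).
Proof.
by apply/measurable_EFinP; apply: measurable_indic; exact: measurable_inner.
Qed.

Lemma measurable_tail_rho : measurable_fun setT (fun x => (V (rho x)) `^ (1 - gamma)%R).
Proof.
apply: (@measurable_antitone _ _ _ _ mrho (fun r => V r `^ (1 - gamma)%R)) => r s rs.
by apply: lee_poweR; [exact: ltW|exact: tail_norm_ge0|exact: V_anti].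
Qed.

Lemma measurable_hardy_profile r : measurable_fun setT (hardy_profile r).
Proof.
by apply: emeasurable_funM; [exact: measurable_indic_inner|exact: measurable_tail_rho].
Qed.

Lemma hardy_profile_ge0 r x : 0 <= hardy_profile r x.
Proof. by rewrite /hardy_profile mule_ge0 ?poweR_ge0 ?lee_fin. Qed.

(** If [V r] were infinite, the profile would be positive on the whole ball, so its norm would be
    positive and the product infinite. *)
Lemma tail_finite_of_bound (r : R) : (0 < r)%R ->
  V r `^ gamma * Nw (hardy_profile r) < +oo -> V r < +oo.
Proof.
move=> r0 Boo; rewrite ltey; apply/eqP => Voo; move: Boo; rewrite Voo.
have N0 : 0 < Nw (hardy_profile r).
  apply: (weighted_norm_gt0 N_BFS w_weight (measurable_inner mrho r) (inner_gt0 r0)).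
  - exact: measurable_hardy_profile.
  - exact: hardy_profile_ge0.
  - move=> x /= xr; rewrite /hardy_profile indic_boolE xr mul1e poweR_gt0//.
    by apply: lt_le_trans (V_anti (ltW xr)); rewrite Voo.
by rewrite eqy_poweR// gt0_mulye.
Qed.

Variable B : R.
Hypothesis B_ge0 : (0 <= B)%R.
Hypothesis HB : forall r, (0 < r)%R -> V r `^ gamma * Nw (hardy_profile r) <= B%:E.

Let V_fin r : (0 < r)%R -> V r < +oo.
Proof.
by move=> r0; apply: tail_finite_of_bound => //; exact: le_lt_trans (HB r0) (ltry _).
Qed.

Variable f : T -> \bar R.
Hypotheses (mf : measurable_fun setT f) (f_ge0 : forall y, 0 <= f y).
Hypothesis fv_fin : \int[mu]_y (f y * v y) `^ p < +oo.

Local Notation H r := (\int[mu]_(y in [set y | (r < rho y)%R]) f y).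

Let fvE := \int[mu]_y (f y * v y) `^ p.

Let mfv : measurable_fun setT (fun y => (f y * v y) `^ p).
Proof.
have [mv _ _] := v_weight.
by apply: (measurableT_comp (measurable_poweR _)); exact: emeasurable_funM.
Qed.

(** By [hardy_grid_le], [F] is dominated pointwise by the [p]-sum of the functions [g k], to which
    p-convexity applies. The norm of [g k] is controlled by [HB] at radius [s k]. *)
Lemma hardy_step_function_le K (s : nat -> R) (F : T -> \bar R) :
  (forall i, (i <= K)%N -> (0 < s i)%R) ->
  {homo s : i j / (i <= j)%N >-> (j <= i)%R} ->
  measurable_fun setT F -> (forall x, 0 <= F x) ->
  (forall x, F x = 0 \/ exists j, [/\ (j <= K)%N, (rho x < s j)%R & F x = H (s j)]) ->
  Nw F <= (M * upper_factor gamma p * B)%R%:E * fvE `^ p^-1.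
Proof.
move=> s0 ns mF F0 FH.
pose alpha := shell_mass mu p v f rho s.
have alpha0 k : (0 <= alpha k)%R by exact: shell_mass_ge0.
(* [V] may be infinite at radius 0 while p-convexity concerns real-valued functions; freezing the
   radius below [s K] keeps [u] finite. *)
pose u x := (fine (V (Order.max (rho x) (s K))) `^ (1 - gamma))%R.
have Vf r : (0 < r)%R -> V r \is a fin_num.
  by move=> r0; rewrite ge0_fin_numE ?tail_norm_ge0 ?V_fin.
have umax x : (0 < Order.max (rho x) (s K))%R by rewrite lt_max s0// orbT.
have uE x : (u x)%:E = V (Order.max (rho x) (s K)) `^ (1 - gamma)%R.
  by rewrite -[in RHS](fineK (Vf _ (umax x))).
have mu_u : measurable_fun setT u.
  apply/measurable_EFinP; rewrite (_ : EFin \o u =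
    (fun r => V (Order.max r (s K)) `^ (1 - gamma)%R) \o rho); last first.
    by apply/funext => x /=; rewrite uE.
  apply: measurable_antitone => // r r' rr'.
  apply: lee_poweR; [exact: ltW|exact: tail_norm_ge0|apply: V_anti].
  by rewrite ge_max !le_max rr' lexx orbT.
have u0 x : (0 <= u x)%R by exact: powR_ge0.
(* Chosen so that [cf k ^ p] is the summand of index [k] in [hardy_grid_le]. *)
pose cf k := (alpha k `^ p^-1 * fine (V (s k)) `^ gamma)%R.
have cf0 k : (0 <= cf k)%R by rewrite mulr_ge0 ?powR_ge0.
have cfp k : (cf k `^ p = alpha k * fine (V (s k)) `^ (gamma * p))%R.
  rewrite /cf (powRM _ (powR_ge0 _ _) (powR_ge0 _ _)).
  by rewrite -(powRrM (alpha k)) mulVf ?gt_eqF// (powRr1 (alpha0 k)) powRrM.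
pose g (k : 'I_K.+1) x := (cf k * ((rho x < s k)%R%:R * u x))%R.
have mg k : measurable_fun setT (g k).
  apply: measurable_funM => //; apply: measurable_funM => //.
  rewrite (_ : (fun x => _) = \1_[set z | (rho z < s k)%R]).
    by apply: measurable_indic; exact: measurable_inner.
  by apply/funext => x; rewrite indic_boolE.
have bu0 k x : (0 <= (rho x < s k)%R%:R * u x)%R by rewrite mulr_ge0 ?ler0n.
have g0 k x : (0 <= g k x)%R by rewrite /g mulr_ge0.
have Ng (k : 'I_K.+1) : Nw (EFin \o g k) <= (alpha k `^ p^-1 * B)%R%:E.
  have sk0 : (0 < s k)%R by rewrite s0// -ltnS.
  have mh : measurable_fun setT (fun x => ((rho x < s k)%R%:R * u x)%R%:E).
    apply/measurable_EFinP; apply: measurable_funM => //.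
    rewrite (_ : (fun x => _) = \1_[set z | (rho z < s k)%R]).
      by apply: measurable_indic; exact: measurable_inner.
    by apply/funext => x; rewrite indic_boolE.
  have -> : EFin \o g k = (fun x => (cf k)%:E * ((rho x < s k)%R%:R * u x)%R%:E).
    by apply/funext => x.
  rewrite (weighted_normZ N_BFS w_weight)//; last first.
    by move=> x; rewrite lee_fin.
  rewrite /cf EFinM -muleA EFinM; apply: lee_wpmul2l; first by rewrite lee_fin powR_ge0.
  apply: le_trans (HB sk0); rewrite -[in X in _ <= X](fineK (Vf _ sk0)) poweR_EFin.
  apply: lee_wpmul2l; first by rewrite lee_fin powR_ge0.
  apply: (weighted_norm_le N_BFS w_weight) => //; first exact: measurable_hardy_profile.
  move=> x; rewrite lee_fin bu0/= /hardy_profile indic_boolE EFinM.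
  apply: lee_wpmul2l; first by rewrite lee_fin.
  rewrite uE; apply: lee_poweR; [exact: ltW|exact: tail_norm_ge0|].
  by apply: V_anti; rewrite le_max lexx.
have Ngoo k : measurable_fun setT (g k) /\ Nw (EFin \o g k) < +oo.
  by split => //; exact: le_lt_trans (Ng k) (ltry _).
have kap0 : (0 < upper_factor gamma p)%R by exact: upper_factor_gt0.
have msum : measurable_fun setT (fun x => ((\sum_(k < K.+1) `|g k x| `^ p) `^ p^-1)%R%:E).
  apply/measurable_EFinP; apply: (measurableT_comp (measurable_powR _)).
  apply: measurable_sum => k; apply: (measurableT_comp (measurable_powR _)).
  exact: measurableT_comp.
have sum0 x : (0 <= (\sum_(k < K.+1) `|g k x| `^ p) `^ p^-1)%R by exact: powR_ge0.
apply: (@le_trans _ _ (Nw (fun x => (upper_factor gamma p)%:E *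
    ((\sum_(k < K.+1) `|g k x| `^ p) `^ p^-1)%R%:E))).
  apply: (weighted_norm_le N_BFS w_weight) => //; first exact: measurable_funeM.
  move=> x; rewrite F0/=; have [->|[j [jK xj ->]]] := FH x.
    by rewrite mule_ge0 ?lee_fin// ltW.
  apply: le_trans (hardy_grid_le p_ge1 gamma01 v_weight muT_gt0 mf f_ge0 mrho
    outer_gt0 V_fin fv_fin jK s0 ns) _.
  rewrite -EFinM lee_fin -mulrA; apply: ler_wpM2l; first exact: ltW.
  have sj0 := s0 j jK.
  have -> : (fine (V (s j)) `^ (1 - gamma) =
      ((fine (V (s j)) `^ (1 - gamma)) `^ p) `^ p^-1)%R.
    by rewrite -powRrM mulfV ?gt_eqF// powRr1 ?powR_ge0.
  rewrite -powRM ?powR_ge0//; last first.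
    by apply: sumr_ge0 => k _; rewrite mulr_ge0 ?powR_ge0.
  apply: ge0_ler_powR; rewrite ?nnegrE ?invr_ge0 ?(ltW p_gt0)//.
  - rewrite mulr_ge0 ?powR_ge0//.
    by apply: sumr_ge0 => k _; rewrite mulr_ge0 ?powR_ge0.
  - by apply: sumr_ge0 => k _; exact: powR_ge0.
  have ujx : (fine (V (s j)) `^ (1 - gamma) <= u x)%R.
    rewrite -lee_fin uE -[in X in X <= _]poweR_EFin fineK ?Vf//.
    apply: lee_poweR; [exact: ltW|exact: tail_norm_ge0|apply: V_anti].
    by rewrite ge_max (ltW xj) ns.
  rewrite mulr_suml (_ : (\sum_(k < K.+1) `|g k x| `^ p =
      \sum_(0 <= k < K.+1) `|cf k * ((rho x < s k)%R%:R * u x)| `^ p)%R); last first.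
    by rewrite big_mkord.
  (* Only the terms [k <= j] are kept: for these, [rho x < s j <= s k], so the indicator equals
     1. *)
  rewrite (big_cat_nat (n := j.+1) (p := K.+1))//=.
  apply: (@le_trans _ _
    (\sum_(0 <= k < j.+1) `|cf k * ((rho x < s k)%R%:R * u x)| `^ p)%R); last first.
    by rewrite lerDl sumr_ge0// => k _; exact: powR_ge0.
  rewrite !big_mkord; apply: ler_sum => k _.
  have kj : (k <= j)%N by rewrite -ltnS.
  rewrite (lt_le_trans xj (ns _ _ kj)) mul1r ger0_norm; last first.
    by rewrite mulr_ge0.
  rewrite (powRM _ (cf0 k) (u0 x)) cfp.
  apply: ler_wpM2l; first exact: mulr_ge0 (alpha0 k) (powR_ge0 _ _).
  by apply: ge0_ler_powR ujx; rewrite ?nnegrE ?(ltW p_gt0) ?powR_ge0.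
rewrite (weighted_normZ N_BFS w_weight) ?(ltW kap0)//.
rewrite (mulrC M) -mulrA EFinM -muleA; apply: lee_wpmul2l; first by rewrite lee_fin ltW.
apply: le_trans (w_convex Ngoo) _.
rewrite EFinM -muleA; apply: lee_wpmul2l; first by rewrite lee_fin ltW.
have NgE (k : 'I_K.+1) : 0 <= Nw (EFin \o g k).
  by apply: (weighted_norm_ge0 N_BFS w_weight); exact/measurable_EFinP.
(* Writing [B] as a root of its [p]-th power allows a comparison of [p]-th powers, termwise under
   the sum. *)
have BE : B%:E = (B%:E `^ p) `^ p^-1 by rewrite poweRVK.
rewrite [in X in _ <= X * _]BE -poweRM ?poweR_ge0 ?integral_ge0//; last first.
  by move=> x _; exact: poweR_ge0.
apply: lee_poweR; first by rewrite invr_ge0 ltW.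
  by apply: sume_ge0 => k _; exact: poweR_ge0.
apply: (@le_trans _ _ (\sum_(k < K.+1) (B `^ p * alpha k)%R%:E)).
  apply: lee_sum => k _.
  apply: (@le_trans _ _ ((alpha k `^ p^-1 * B)%R%:E `^ p)).
    by apply: lee_poweR; rewrite ?(ltW p_gt0).
  by rewrite poweR_EFin powRM ?powR_ge0// -powRrM mulVf ?gt_eqF// powRr1// mulrC.
rewrite sumEFin -mulr_sumr EFinM poweR_EFin.
apply: lee_wpmul2l; first by rewrite lee_fin powR_ge0.
rewrite -(big_mkord xpredT) (sum_shell_mass v_weight mf mrho fv_fin K ns).
apply: ge0_subset_integral => //; first exact: measurable_outer.
by move=> x _; exact: poweR_ge0.
Qed.

(** Exhausting the space by balls of radius [k + 1] reduces the claim to bounded radii, where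
    [radial_fatou] leaves only step functions. *)
Lemma hardy_upper : Nw (fun x => H (rho x)) <=
  (M * upper_factor gamma p * B)%R%:E * fvE `^ p^-1.
Proof.
have nH r s : (r <= s)%R -> H s <= H r by exact: integral_outer_le.
have H0 r : 0 <= H r by exact: integral_ge0.
have mH : measurable_fun setT (fun x => H (rho x)).
  exact: (@measurable_antitone _ _ _ _ mrho (fun r => H r)).
apply: (weighted_norm_fatou N_BFS w_weight
  (F := fun k x => (\1_[set z | (rho z < k.+1%:R)%R] x)%:E * H (rho x))).
- by move=> k; apply: emeasurable_funM => //; exact: measurable_indic_inner.
- by move=> k x; rewrite mule_ge0 ?lee_fin.
- move=> x i j ij; apply: lee_wpmul2r => //; rewrite lee_fin !indic_boolE ler_nat.
  case: ltP => // xi; suff -> : (rho x < j.+1%:R)%R by [].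
  by rewrite (lt_le_trans xi)// ler_nat.
- move=> x; apply: cvg_near_cst; near=> k.
  rewrite indic_boolE (_ : (rho x < k.+1%:R)%R); first by rewrite mul1e.
  apply: (lt_le_trans (truncnS_gt (rho x))); rewrite ler_nat ltnS.
  by near: k; exact: nbhs_infty_ge.
move=> k; apply: (radial_fatou mrho rho_ge0 N_BFS w_weight (phi := fun r => H r)) => //.
  by move=> r z; exact: integral_outer_right.
move=> K s F _ s0 ns mF F0 FH; exact: hardy_step_function_le FH.
Unshelve. all: by end_near. Qed.

End hardy_upper.

(** * Necessity *)

Section extremal_functions.
Context d (T : measurableType d) (R : realType).
Variables (mu : {sigma_finite_measure set T -> \bar R}) (v : T -> \bar R).
Hypotheses (v_weight : is_weight mu v) (mu_gt0 : 0 < mu setT).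

Let mv : measurable_fun setT v. Proof. by have [] := v_weight. Qed.
Let v_gt0 y : 0 < v y. Proof. by have [] := v_weight. Qed.

(** Since [c] is below the essential supremum, [v^-1 > c] on some [B] inside [S] of positive finite
    measure; [f] is the normalized indicator of [B]. *)
Lemma tail_norm1_extremal (S : set T) (c : R) : measurable S -> (0 < c)%R ->
  c%:E < tail_norm mu 1 v S ->
  exists f : T -> \bar R, [/\ measurable_fun setT f, forall y, 0 <= f y,
    \int[mu]_(y in S) f y = 1 & \int[mu]_y (f y * v y) <= c^-1%:E].
Proof.
move=> mS c0; rewrite tail_norm1E// => cV.
pose A := S `&` [set y | c%:E < (v y)^-1].
have mA : measurable A.
  apply: emeasurable_fun_o_infty => //; apply: measurable_funTS.
  exact: measurable_inve.
have A0 : 0 < mu A.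
  rewrite lt_neqAle measure_ge0 andbT; apply/eqP => /esym muA.
  move: cV; rewrite ltNge => /negP; apply; apply/ess_supP.
  exists A; split => // y /= /negP; rewrite -ltNge indicE.
  have [/set_mem Sy|_] := boolP (y \in S); first by rewrite mul1e.
  by rewrite mul0e lte_fin ltNge (ltW c0).
have [B [mB BA B0 Boo]] := sigma_finite_subset_gt0 mA A0.
have Bfin : mu B \is a fin_num by rewrite ge0_fin_numE.
have b0 : (0 < fine (mu B))%R by rewrite fine_gt0// B0.
have mi : measurable_fun setT (fun y => (\1_B y)%:E : \bar R).
  by apply/measurable_EFinP; exact: measurable_indic.
pose f y := ((fine (mu B))^-1)%:E * (\1_B y)%:E : \bar R.
have f0 y : 0 <= f y by rewrite mule_ge0 ?lee_fin ?invr_ge0 ?(ltW b0).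
have BS : B `<=` S by move=> y /BA[].
have cE : ((fine (mu B))^-1)%:E * mu B = 1 :> \bar R.
  by rewrite -[in X in _ * X](fineK Bfin) -EFinM mulVf// gt_eqF.
exists f; split => //.
- exact: measurable_funeM.
- rewrite ge0_integralZl//; [|exact: measurable_funTS|by rewrite lee_fin invr_ge0 ltW].
  by rewrite integral_indic// (setIidl BS).
apply: (@le_trans _ _ (\int[mu]_y (c^-1%:E * f y))).
  apply: ge0_le_integral => //.
  - by move=> y _; rewrite mule_ge0// ltW.
  - by apply: emeasurable_funM => //; exact: measurable_funeM.
  - by apply: measurable_funeM; exact: measurable_funeM.
  - move=> y _; rewrite /f indicE; have [/set_mem /BA[_ /= cv]|_] := boolP (y \in B).
      rewrite mule1 muleC; apply: lee_wpmul2r; first by rewrite lee_fin invr_ge0 ltW.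
      have vc : v y < c%:E^-1 by rewrite inve_pgt ?inE//= ?lee_fin ltW.
      by rewrite (le_trans (ltW vc))// inver gt_eqF.
    by rewrite mule0 mul0e mule0.
rewrite ge0_integralZl//; last 2 first.
- exact: measurable_funeM.
- by rewrite lee_fin invr_ge0 ltW.
rewrite ge0_integralZl//; last first.
  by rewrite lee_fin invr_ge0 ltW.
by rewrite integral_indic// setIT cE mule1.
Qed.

Variable p : R.
Hypothesis p_gt1 : (1 < p)%R.
Let q := (p / (p - 1))%R.

Let p_gt0 : (0 < p)%R. Proof. exact: lt_trans p_gt1. Qed.
Let p1_gt0 : (0 < p - 1)%R. Proof. by rewrite subr_gt0. Qed.
Let q_gt0 : (0 < q)%R. Proof. exact: divr_gt0. Qed.

(** The identity [(q - 1) p = q] makes [v ^ (- q)] extremal in Hoelder's inequality; where [v = +oo]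
    both sides are 0. *)
Lemma dual_density_pow (c : R) y : (0 <= c)%R ->
  (c%:E * (v y)^-1 `^ q * v y) `^ p = (c `^ p)%R%:E * (v y)^-1 `^ q.
Proof.
move=> c0; move: (v_gt0 y); case: (v y) => [r||]//.
  rewrite lte_fin => r0; rewrite inver gt_eqF// !poweR_EFin -!EFinM; congr EFin.
  have rV0 : (0 < r^-1)%R by rewrite invr_gt0.
  have rqE : (r^-1 `^ q * r = r^-1 `^ (q - 1))%R.
    have -> : (r^-1 `^ q = r^-1 `^ (q - 1) * r^-1)%R.
      by rewrite -[X in (_ = _ * X)%R]powRr1 ?(ltW rV0)// -powRD ?subrK// gt_eqF ?implybT.
    by rewrite mulfVK// gt_eqF.
  rewrite -mulrA rqE powRM ?powR_ge0// -powRrM; congr (_ * _ `^ _)%R.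
  by rewrite /q; field; rewrite gt_eqF.
by move=> _; rewrite invey poweR0r ?gt_eqF// mule0 mul0e poweR0r ?mule0// gt_eqF//.
Qed.


Lemma integral_dual_density (c : R) (S : set T) : (0 <= c)%R -> measurable S ->
  tail_norm mu p v S < +oo ->
  \int[mu]_(y in S) (c%:E * (v y)^-1 `^ q) = (c * fine (tail_norm mu p v S) `^ q)%R%:E.
Proof.
move=> c0 mS Soo.
have S_fin : tail_norm mu p v S \is a fin_num by rewrite ge0_fin_numE ?tail_norm_ge0.
rewrite ge0_integralZl//; last 2 first.
- apply: measurable_funTS; apply: (measurableT_comp (measurable_poweR _)).
  exact: measurable_inve.
- by move=> y _; exact: poweR_ge0.
rewrite EFinM -poweR_EFin fineK// tail_normE// -/q -poweRrM mulVf ?gt_eqF// poweRe1//.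
by apply: integral_ge0 => y _; exact: poweR_ge0.
Qed.

Variable gamma : R.
Hypothesis gamma01 : (0 < gamma < 1)%R.
Let gamma_gt0 : (0 < gamma)%R. Proof. by case/andP: gamma01. Qed.
Let gamma_lt1 : (0 < 1 - gamma)%R. Proof. by case/andP: gamma01; rewrite subr_gt0. Qed.

Variable rho : T -> R.
Hypothesis mrho : measurable_fun setT rho.
Local Notation V r := (tail_norm mu p v [set y | (r < rho y)%R]).
Hypothesis V_fin : forall r, (0 < r)%R -> 0 < V r < +oo.

Let kappa := (q / (1 - gamma))%R.
Let kappa_gt0 : (0 < kappa)%R. Proof. exact: divr_gt0. Qed.

(** [f] is [v ^ (- q)] times a constant on each shell, built from the outside inwards. The constants
    make the tail integrals telescope exactly, while Jensen's inequality controls the cost of each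
    shell. *)
Lemma hardy_test_function (s : nat -> R) K : (forall i, (i <= K)%N -> (0 < s i)%R) ->
  {homo s : i j / (i <= j)%N >-> (j <= i)%R} ->
  exists f : T -> \bar R, [/\ measurable_fun setT f, forall y, 0 <= f y,
    forall k, (k <= K)%N -> (kappa * fine (V (s k)) `^ (1 - gamma))%R%:E <=
      \int[mu]_(y in [set y | (s k < rho y)%R]) f y &
    \int[mu]_y (f y * v y) `^ p <=
      (fine (V (s 0%N)) `^ (- (gamma * p)) * (kappa `^ p + (gamma * (p - 1))^-1))%R%:E].
Proof.
move=> s0 ns.
have [W WE] : exists W : nat -> R, forall k, W k = (fine (V (s k)) `^ q)%R.
  by exists (fun k => fine (V (s k)) `^ q)%R.
have V0 k : (k <= K)%N -> (0 < fine (V (s k)))%R.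
  by move=> kK; rewrite fine_gt0// V_fin// s0.
have W0 k : (k <= K)%N -> (0 < W k)%R by move=> kK; rewrite WE powR_gt0// V0.
(* The exponent for which [kappa W ^ (1 - beta)] is the integral of [u ^ (- beta)] over [[0, W]] and
   equals [kappa V ^ (1 - gamma)]. Moreover [beta p - 1 = gamma (p - 1)] is positive. *)
pose beta := (1 - (1 - gamma) / q)%R.
have betaE : (1 - beta = kappa^-1)%R.
  by rewrite /beta /kappa; field; rewrite !gt_eqF.
have betapE : (beta * p - 1 = gamma * (p - 1))%R.
  by rewrite /beta /q; field; rewrite !gt_eqF.
have bp0 : (0 < gamma * (p - 1))%R by rewrite mulr_gt0.
have q_gt1 : (1 < q)%R by rewrite /q ltr_pdivlMr// mul1r ltrBlDr ltrDl.
have kappa_gt1 : (1 < kappa)%R.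
  rewrite /kappa ltr_pdivlMr// mul1r (lt_trans _ q_gt1)//.
  by case/andP: gamma01; rewrite ltrBlDr ltrDl.
have beta01 : (0 < beta < 1)%R.
  rewrite -(subr_gt0 beta) betaE invr_gt0 kappa_gt0 andbT.
  by rewrite -[beta](subKr 1%R) betaE subr_gt0 invf_lt1.
have WV k : (k <= K)%N -> (W k `^ (1 - beta) = fine (V (s k)) `^ (1 - gamma))%R.
  move=> kK; rewrite WE -powRrM betaE /kappa; congr (_ `^ _)%R.
  by field; rewrite !gt_eqF.
have WVp k : (k <= K)%N -> (W k `^ (1 - beta * p) = fine (V (s k)) `^ (- (gamma * p)))%R.
  move=> kK; rewrite WE -powRrM -opprB betapE /q; congr (_ `^ _)%R.
  by field; rewrite !gt_eqF.
have powRNM (x e : R) : (0 < x -> x `^ (- e) * x = x `^ (1 - e))%R.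
  by move=> x0; rewrite powRD ?powRr1 1?mulrC ?(ltW x0)// (gt_eqF x0) implybT.
have mdens (c : R) S : measurable S -> (0 <= c)%R ->
    measurable_fun setT ((fun y => c%:E * (v y)^-1 `^ q) \_ S).
  move=> mS c0; apply/(measurable_restrictT _ mS).1; apply: measurable_funTS.
  apply: measurable_funeM; apply: (measurableT_comp (measurable_poweR _)).
  exact: measurable_inve.
have densv (c : R) S y : (0 <= c)%R ->
    (((fun y => c%:E * (v y)^-1 `^ q) \_ S) y * v y) `^ p =
    ((fun y => (c `^ p)%R%:E * (v y)^-1 `^ q) \_ S) y.
  move=> c0; rewrite !patchE; case: ifP => _; first exact: dual_density_pow.
  by rewrite mul0e poweR0r// gt_eqF.
have dens0 (c : R) S y : (0 <= c)%R -> 0 <= ((fun y => c%:E * (v y)^-1 `^ q) \_ S) y.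
  by move=> c0; rewrite patchE; case: ifP => // _; rewrite mule_ge0 ?lee_fin ?poweR_ge0.
pose O k := [set y | (s k < rho y)%R].
have mO k : measurable (O k) by exact: measurable_outer.
(* The induction also records that [f] vanishes outside [O i], so that [p]-th powers add when a
   shell is joined, and keeps the negative term in [W i] for the telescoping. *)
suff : forall i, (i <= K)%N -> exists f : T -> \bar R,
    [/\ measurable_fun setT f, forall y, 0 <= f y /\ (~ O i y -> f y = 0),
    forall k, (k <= i)%N -> (kappa * W k `^ (1 - beta))%R%:E <= \int[mu]_(y in O k) f y &
    \int[mu]_y (f y * v y) `^ p <= (kappa `^ p * W 0%N `^ (1 - beta * p) +
      (W 0%N `^ (1 - beta * p) - W i `^ (1 - beta * p)) / (beta * p - 1))%R%:E].
  move=> /(_ K (leqnn K)) [f [mf f0 Hf fvp]]; exists f; split => //.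
  - by move=> y; have [] := f0 y.
  - by move=> k kK; rewrite -WV// Hf.
  - apply: le_trans fvp _;
    rewrite lee_fin -(WVp 0%N)// betapE [leRHS]mulrDr (mulrC (kappa `^ p)%R).
    by rewrite lerD2l ler_pM2r ?invr_gt0// gerBl powR_ge0.
elim => [_|i IH iK].
  (* The mean of [u ^ (- beta)] over [[0, W 0]]. Its cost is computed exactly, since
     [u ^ (- beta p)] is not integrable at 0; this produces the term [kappa ^ p]. *)
  pose c := (kappa * W 0%N `^ (- beta))%R.
  have c0 : (0 <= c)%R by rewrite mulr_ge0 ?powR_ge0// ltW.
  have VO : V (s 0%N) < +oo by case/andP: (V_fin (s0 0%N (leq0n _))).
  exists ((fun y => c%:E * (v y)^-1 `^ q) \_ (O 0%N)); split.
  - exact: mdens.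
  - move=> y; split; first exact: dens0.
    by move=> nO; rewrite patchE memNset.
  - move=> k; rewrite leqn0 => /eqP ->.
    rewrite -integral_mkcondl setIid integral_dual_density// lee_fin /c -WE.
    by rewrite -mulrA (powRNM _ _ (W0 0%N (leq0n _))).
  - under eq_integral do rewrite densv//.
    rewrite -integral_mkcond integral_dual_density ?powR_ge0// lee_fin subrr mul0r addr0.
    rewrite -WE /c powRM ?powR_ge0 ?(ltW kappa_gt0)// -powRrM -mulrA.
    by rewrite mulNr (powRNM _ _ (W0 0%N (leq0n _))).
have iK' : (i <= K)%N by exact: ltnW.
have [f [mf f0 Hf fvp]] := IH iK'.
have ss : (s i.+1 <= s i)%R by exact: ns.
pose S := [set y | (s i.+1 < rho y <= s i)%R].
have mS : measurable S by exact: measurable_shell.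
have OE : O i.+1 = S `|` O i by exact: outer_shell.
have SO : [disjoint S & O i] by exact: disj_shell.
set a := W i.+1; set b := W i.
pose m := fine (tail_norm mu p v S).
have V_fin_ k : (k <= K)%N -> V (s k) \is a fin_num.
  move=> kK; have /andP[V0_ Voo] := V_fin (s0 k kK).
  by rewrite ge0_fin_numE// ltW.
have Soo : tail_norm mu p v S < +oo.
  have /andP[_] := V_fin (s0 _ iK); apply: le_lt_trans.
  apply: (tail_norm_subset (ltW p_gt1) v_weight mu_gt0 mS (mO i.+1)).
  by rewrite OE; exact: subsetUl.
have S_fin : tail_norm mu p v S \is a fin_num by rewrite ge0_fin_numE ?tail_norm_ge0.
have abE : (m `^ q = a - b)%R.
  have := tail_norm_setU p_gt1 v_weight mS (mO i) SO.
  rewrite -OE -/q -(fineK (V_fin_ _ iK)) -(fineK (V_fin_ _ iK')) -(fineK S_fin).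
  by rewrite !poweR_EFin -EFinD => -[E]; rewrite /a /b !WE E addrK.
have ba : (b <= a)%R by rewrite -subr_ge0 -abE powR_ge0.
have b0 : (0 < b)%R by exact: W0.
(* The mean of [u ^ (- beta)] over [[b, a]]; it is 0 when [a = b], by the convention for division by
   0. *)
pose c := ((a `^ (1 - beta) - b `^ (1 - beta)) / ((1 - beta) * (a - b)))%R.
have beta1 : (0 < 1 - beta)%R by rewrite betaE invr_gt0.
have c0 : (0 <= c)%R.
  apply: divr_ge0; last by apply: mulr_ge0; [exact: ltW|rewrite subr_ge0].
  have a0 : (0 <= a)%R by exact: le_trans (ltW b0) ba.
  by rewrite subr_ge0; apply: ge0_ler_powR ba; rewrite ?nnegrE ?(ltW beta1) ?(ltW b0).
have cE : (c * (a - b) = kappa * (a `^ (1 - beta) - b `^ (1 - beta)))%R.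
  rewrite /c betaE; have [->|ab] := eqVneq a b; first by rewrite !subrr mulr0 mulr0.
  by field; rewrite subr_eq0 ab/= gt_eqF.
pose h := (fun y => c%:E * (v y)^-1 `^ q) \_ S.
have fh y : f y = 0 \/ h y = 0.
  have [/set_mem Sy|nSy] := boolP (y \in S); last first.
    by right; rewrite /h patchE (negbTE nSy).
  left; have [_] := f0 y; apply => Oy.
  by move/disj_set2P : SO => /seteqP[/(_ y) + _]; apply.
have f_ge0 y : 0 <= f y by have [] := f0 y.
have h_ge0 y : 0 <= h y by exact: dens0.
have mh : measurable_fun setT h by exact: mdens.
have mfv (g : T -> \bar R) : measurable_fun setT g ->
    measurable_fun setT (fun y => (g y * v y) `^ p).
  move=> mg; apply: (measurableT_comp (measurable_poweR _)).
  exact: emeasurable_funM.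
exists (fun y => f y + h y); split.
- exact: emeasurable_funD.
- move=> y; split; first exact: adde_ge0.
  move=> nO; rewrite (f0 y).2; last by move=> Oi; apply: nO; rewrite OE; right.
  rewrite add0e /h patchE ifF//; apply/negbTE; rewrite notin_setE => Sy.
  by apply: nO; rewrite OE; left.
- move=> k; rewrite leq_eqVlt => /predU1P[->|ki]; last first.
    apply: le_trans (Hf k ki) _; apply: ge0_le_integral => //.
    + exact: measurable_funTS.
    + by apply: measurable_funTS; exact: emeasurable_funD.
    + by move=> y _; rewrite leeDl.
  rewrite ge0_integralD//; try exact: measurable_funTS.
  apply: (@le_trans _ _ (\int[mu]_(y in O i) f y + \int[mu]_(y in S) h y)).
    rewrite (eq_integral (fun y => c%:E * (v y)^-1 `^ q) h); last first.
      by move=> y yS; rewrite /h patchE yS.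
    rewrite integral_dual_density// -/m abE cE.
    apply: le_trans (leeD (Hf i (leqnn i)) (lexx _)).
    by rewrite -EFinD lee_fin /a /b; lra.
  apply: leeD; apply: ge0_subset_integral => //; try exact: measurable_funTS.
  + by rewrite OE; exact: subsetUr.
  + by rewrite OE; exact: subsetUl.
- rewrite (eq_integral (fun y => (f y * v y) `^ p + (h y * v y) `^ p)); last first.
    move=> y _; have [->|->] := fh y.
      by rewrite add0e mul0e poweR0r ?add0e// gt_eqF.
    by rewrite adde0 mul0e (poweR0r (r := p)) ?adde0// gt_eqF.
  rewrite ge0_integralD//; [|by move=> y _; exact: poweR_ge0|exact: mfv
    |by move=> y _; exact: poweR_ge0|exact: mfv].
  have -> : \int[mu]_y (h y * v y) `^ p = (c `^ p * (a - b))%R%:E.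
    under eq_integral do rewrite densv//.
    by rewrite -integral_mkcond integral_dual_density ?powR_ge0// -/m abE.
  apply: le_trans (leeD fvp (lexx _)) _; rewrite -EFinD lee_fin -addrA lerD2l.
  have bp1 : (1 < beta * p)%R by rewrite -subr_gt0 betapE.
  (* Jensen's inequality bounds the cost of the new shell by the next difference of the telescoping
     sum. *)
  have := powR_mean_le p_gt1 beta01 bp1 b0 ba; rewrite -/c -/a => P.
  rewrite -lerBrDl -mulrBl; apply: (le_trans P).
  by rewrite ler_pM2r ?invr_gt0 ?betapE// /a /b; lra.
Qed.

End extremal_functions.

Section hardy_lower.
Context d (T : measurableType d) (R : realType).
Variables (mu : {sigma_finite_measure set T -> \bar R}) (N : (T -> R) -> \bar R).
Variables (p C : R) (v w : T -> \bar R) (rho : T -> R).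
Hypotheses (p_ge1 : (1 <= p)%R).
Hypotheses (v_weight : is_weight mu v) (w_weight : is_weight mu w).
Hypotheses (N_BFS : is_BFS mu N) (C_gt0 : (0 < C)%R).
Hypotheses (mrho : measurable_fun setT rho) (rho_ge0 : forall x, (0 <= rho x)%R).
Hypothesis outer_gt0 : forall r, (0 < r)%R -> 0 < mu [set y | (r < rho y)%R].
Hypothesis inner_gt0 : forall r, (0 < r)%R -> 0 < mu [set y | (rho y < r)%R].

Local Notation Nw := (weighted_norm mu N w).
Local Notation V r := (tail_norm mu p v [set y | (r < rho y)%R]).

Hypothesis hardy : forall f : T -> \bar R,
  measurable_fun setT f -> (forall y, 0 <= f y) ->
  Nw (fun x => \int[mu]_(y in [set y | (rho x < rho y)%R]) f y) <=
  C%:E * (\int[mu]_y (f y * v y) `^ p) `^ p^-1.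

Let mv : measurable_fun setT v. Proof. by have [] := v_weight. Qed.
Let v_gt0 y : 0 < v y. Proof. by have [] := v_weight. Qed.
Let p_gt0 : (0 < p)%R. Proof. exact: lt_le_trans p_ge1. Qed.

Let muT_gt0 : 0 < mu setT.
Proof.
apply: lt_le_trans (outer_gt0 ltr01) _.
by apply: le_measure; rewrite ?inE//; exact: measurable_outer.
Qed.

Let mH (f : T -> \bar R) : measurable_fun setT f -> (forall y, 0 <= f y) ->
  measurable_fun setT (fun x => \int[mu]_(y in [set y | (rho x < rho y)%R]) f y).
Proof.
move=> mf f0; apply: (@measurable_antitone _ _ _ _ mrho
  (fun r => \int[mu]_(y in [set y | (r < rho y)%R]) f y)) => r s.
exact: integral_outer_le.
Qed.

Lemma hardy_inner_bound (f : T -> \bar R) (t a : R) :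
  measurable_fun setT f -> (forall y, 0 <= f y) -> (0 <= a)%R ->
  a%:E <= \int[mu]_(y in [set y | (t < rho y)%R]) f y ->
  a%:E * Nw (fun x => (\1_[set z | (rho z < t)%R] x)%:E) <=
  C%:E * (\int[mu]_y (f y * v y) `^ p) `^ p^-1.
Proof.
move=> mf f0 a0 af; have mi := measurable_indic_inner mrho t.
rewrite -(weighted_normZ N_BFS w_weight a0 mi) ?lee_fin//.
apply: le_trans (hardy mf f0).
apply: (weighted_norm_le N_BFS w_weight); [exact: measurable_funeM|exact: mH|].
move=> x; rewrite mule_ge0 ?lee_fin//= indic_boolE; case: ltP => xt; last first.
  by rewrite mule0 integral_ge0.
by rewrite mule1 (le_trans af)// integral_outer_le// ltW.
Qed.

Let inner_norm_bound t : (0 < t)%R -> exists n0 : R, (0 < n0)%R /\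
  n0%:E <= Nw (fun x => (\1_[set z | (rho z < t)%R] x)%:E).
Proof.
move=> t0; have : 0 < Nw (fun x => (\1_[set z | (rho z < t)%R] x)%:E).
  apply: (weighted_norm_gt0 N_BFS w_weight (measurable_inner mrho t) (inner_gt0 t0)).
  - exact: measurable_indic_inner.
  - by move=> x; rewrite lee_fin.
  - by move=> x /= xt; rewrite indic_boolE xt.
case: (Nw _) => [n||]//.
- by rewrite lte_fin => n0; exists n.
- by exists 1%R; rewrite leey.
Qed.

(** Test functions supported in the exterior of [t] are bounded through [hardy_inner_bound]. For
    [p = 1] a concentrated one contradicts an infinite tail; for [p > 1] truncations of [v ^ (- q)]
    have uniformly bounded integrals. *)
Lemma hardy_tail_finite t : (0 < t)%R -> V t < +oo.
Proof.
move=> t0; have [n0 [n00 nN]] := inner_norm_bound t0.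
have mO : measurable [set y | (t < rho y)%R] by exact: measurable_outer.
have bound (f : T -> \bar R) (a : R) : measurable_fun setT f -> (forall y, 0 <= f y) ->
    (0 <= a)%R -> a%:E <= \int[mu]_(y in [set y | (t < rho y)%R]) f y ->
    (a * n0)%R%:E <= C%:E * (\int[mu]_y (f y * v y) `^ p) `^ p^-1.
  move=> mf f0 a0 af; apply: le_trans (hardy_inner_bound mf f0 a0 af).
  by rewrite EFinM; apply: lee_wpmul2l; rewrite ?lee_fin.
move: (p_ge1); rewrite le_eqVlt => /predU1P[p1|p1].
  rewrite ltNge leye_eq; apply/negP => /eqP Voo.
  (* With this [c] the inequality would give [n0 <= C / c = n0 / 2]. *)
  pose c := (2 * C / n0)%R; have c0 : (0 < c)%R by rewrite divr_gt0 ?mulr_gt0.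
  have cV : c%:E < tail_norm mu 1 v [set y | (t < rho y)%R].
    by rewrite p1 Voo ltry.
  have [f [mf f0 f1 fv]] := tail_norm1_extremal v_weight muT_gt0 mO c0 cV.
  have := bound f 1%R mf f0 ler01; rewrite f1 => /(_ (lexx _)).
  rewrite -p1 invr1 poweRe1; last by apply: integral_ge0 => y _; exact: poweR_ge0.
  under eq_integral do rewrite poweRe1 ?mule_ge0// ?ltW//.
  move=> H; have : (1 * n0)%R%:E <= C%:E * c^-1%:E.
    by apply: le_trans H _; apply: lee_wpmul2l fv; rewrite lee_fin ltW.
  rewrite -EFinM lee_fin /c invf_div; apply/negP; rewrite -ltNge.
  have -> : (C * (n0 / (2 * C)) = n0 / 2)%R by field; rewrite gt_eqF.
  lra.
set q := (p / (p - 1))%R.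
have q0 : (0 < q)%R by rewrite divr_gt0 ?subr_gt0.
have pq : (p^-1 + q^-1 = 1)%R.
  have p1' : (0 < p - 1)%R by rewrite subr_gt0.
  by rewrite /q; field; rewrite !gt_eqF.
pose g y := (v y)^-1 `^ q.
have g0 y : 0 <= g y by exact: poweR_ge0.
have mvV := measurable_inve mv v_gt0.
have mg : measurable_fun setT g by exact: (measurableT_comp (measurable_poweR _)).
have /sigma_finiteP[S [ST ndS Soo]] := sigma_finiteT mu.
pose L k := [set y | (v y)^-1 <= k%:R%:E].
(* On [E k] both [v^-1] and the measure are bounded, so the integral of [g] is known to be finite
   before a power of it is cancelled. *)
pose E k := [set y | (t < rho y)%R] `&` (L k `&` S k).
have mL k : measurable (L k).
  rewrite -[L k]setTI; exact: emeasurable_fun_infty_c.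
have mE k : measurable (E k).
  by apply: measurableI => //; apply: measurableI => //; case: (Soo k).
have ndE : nondecreasing_seq E.
  move=> i j ij; apply/subsetPset; apply: setIS; apply: setISS.
    by move=> y /= /le_trans; apply; rewrite lee_fin ler_nat.
  by apply/subsetPset; exact: ndS.
have EU : \bigcup_k E k = [set y | (t < rho y)%R].
  apply/seteqP; split => [y [k _ []]//|y ty].
  have [i _ Si] : (\bigcup_i S i) y by rewrite -ST.
  have vfin : (v y)^-1 \is a fin_num.
    by rewrite ge0_fin_numE ?inve_ge0 ?(ltW (v_gt0 y))// ltey inve_eqy gt_eqF.
  pose k := maxn i (Num.truncn (fine (v y)^-1)).+1.
  exists k => //; split => //; split.
    rewrite /L/= -(fineK vfin) lee_fin (le_trans (ltW (truncnS_gt _)))//.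
    by rewrite ler_nat leq_maxr.
  by move: Si; apply/subsetPset; apply: ndS; exact: leq_maxl.
have Ebound k : \int[mu]_(y in E k) g y <= ((C / n0) `^ q)%R%:E.
  have Aoo : \int[mu]_(y in E k) g y < +oo.
    apply: (@le_lt_trans _ _ (\int[mu]_(y in E k) (cst (k%:R%:E `^ q)) y)).
      apply: ge0_le_integral => //; first exact: measurable_funTS.
      move=> y [_ [yk _]]; apply: lee_poweR; [exact: ltW| |exact: yk].
      by rewrite inve_ge0 ltW.
    rewrite integral_cst// lte_mul_pinfty ?poweR_ge0//.
    have [mS] := Soo k; apply: le_lt_trans.
    by apply: le_measure; rewrite ?inE// => y [_ []].
  have Afin : \int[mu]_(y in E k) g y \is a fin_num.
    by rewrite ge0_fin_numE ?integral_ge0.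
  have := bound (g \_ (E k)) (fine (\int[mu]_(y in E k) g y)).
  rewrite fineK// -integral_mkcondl (setIidl (A := E k)); last by move=> y [].
  have -> : \int[mu]_y ((g \_ (E k)) y * v y) `^ p = \int[mu]_(y in E k) g y.
    rewrite [RHS]integral_mkcond; apply: eq_integral => y _; rewrite !patchE.
    case: ifP => _; last by rewrite mul0e poweR0r// gt_eqF.
    have := dual_density_pow v_weight p1 y ler01.
    by rewrite !mul1e powR1 mul1e.
  move=> /(_ _ _ _ (lexx _)) H.
  have {}H : (fine (\int[mu]_(y in E k) g y) * n0)%R%:E <=
      C%:E * (\int[mu]_(y in E k) g y) `^ p^-1.
    apply: H.
    - by apply/(measurable_restrictT _ (mE k)).1; exact: measurable_funTS.
    - by move=> y; rewrite patchE; case: ifP.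
    - by rewrite fine_ge0// integral_ge0.
  move: H; rewrite -(fineK Afin) poweR_EFin -EFinM !lee_fin.
  have : (0 <= fine (\int[mu]_(y in E k) g y))%R by rewrite fine_ge0// integral_ge0.
  move: (fine _) => a; rewrite le_eqVlt => /predU1P[<- _|a0]; first exact: powR_ge0.
  (* Cancelling [a ^ (1 / p)] turns [a n0 <= C a ^ (1 / p)] into a bound on [a] that does not depend
     on [k]. *)
  have aE : (a `^ p^-1 * a `^ q^-1 = a)%R.
    by rewrite -powRD ?pq ?oner_eq0// powRr1// ltW.
  move=> H; have {}H : (a `^ p^-1 * (a `^ q^-1 * n0) <= a `^ p^-1 * C)%R.
    by rewrite mulrA aE [leRHS]mulrC.
  move: H; rewrite ler_pM2l ?powR_gt0// => H.
  have {}H : (a `^ q^-1 <= C / n0)%R by rewrite ler_pdivlMr.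
  have -> : (a = (a `^ q^-1) `^ q)%R.
    by rewrite -powRrM mulVf ?gt_eqF// powRr1// ltW.
  by apply: ge0_ler_powR H; rewrite ?nnegrE ?(ltW q0) ?powR_ge0// divr_ge0// ltW.
rewrite tail_normE// -/q; apply: poweR_lty; rewrite -EU.
have := @ge0_nondecreasing_set_cvg_integral _ _ _ _ g mu ndE mE
  (fun=> measurable_funTS mg) (fun _ _ _ => g0 _).
by move/cvgn_le => /(_ _ Ebound)/le_lt_trans; apply; exact: ltry.
Qed.


Variable gamma : R.
Hypothesis gamma01 : (0 < gamma < 1)%R.
Let gamma_gt0 : (0 < gamma)%R. Proof. by case/andP: gamma01. Qed.
Let gamma_lt1 : (0 < 1 - gamma)%R. Proof. by case/andP: gamma01; rewrite subr_gt0. Qed.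

Let V_fin r : (0 < r)%R -> 0 < V r < +oo.
Proof.
move=> r0; rewrite hardy_tail_finite// andbT; apply: tail_norm_gt0 => //.
  exact: measurable_outer.
exact: outer_gt0.
Qed.

(** [radial_fatou] leaves step functions on a grid, so a test function need only be adapted to
    finitely many radii: if [rho x < s j], the tail at [rho x] dominates the one at [s j]. The scale
    [nu] divides out. *)
Lemma hardy_profile_le (t lambda : R) : (0 < t)%R ->
  (forall K (s : nat -> R), s 0%N = t -> (forall i, (i <= K)%N -> (0 < s i)%R) ->
    {homo s : i j / (i <= j)%N >-> (j <= i)%R} ->
    exists f nu, [/\ measurable_fun setT f, forall y, 0 <= f y, (0 < nu)%R,
      forall k, (k <= K)%N -> (nu * fine (V (s k)) `^ (1 - gamma))%R%:E <=
        \int[mu]_(y in [set y | (s k < rho y)%R]) f y &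
      C%:E * (\int[mu]_y (f y * v y) `^ p) `^ p^-1 <= (nu * lambda)%R%:E]) ->
  Nw (hardy_profile mu p gamma v rho t) <= lambda%:E.
Proof.
move=> t0 Htest.
have V_anti r s : (r <= s)%R -> V s <= V r by exact: tail_norm_outer_le.
have V_ge0 r : 0 <= V r by exact: tail_norm_ge0.
apply: (radial_fatou mrho rho_ge0 N_BFS w_weight
  (phi := fun r => V r `^ (1 - gamma)%R)) => //.
- by move=> r s rs; apply: lee_poweR; [exact: ltW|exact: V_ge0|exact: V_anti].
- by move=> r; exact: poweR_ge0.
- move=> r z Vz.
  have z0 : 0 <= z by apply: le_trans (Vz (r + 1)%R _); rewrite ?poweR_ge0// ltrDl.
  (* Rewriting [z] as a power transfers right-continuity from [V] to [V ^ (1 - gamma)]. *)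
  have zV : z = (z `^ (1 - gamma)^-1) `^ (1 - gamma).
    by rewrite -poweRrM mulVf ?gt_eqF// poweRe1.
  rewrite zV; apply: lee_poweR; [exact: ltW|exact: V_ge0|].
  apply: tail_norm_outer_right => // r' /Vz Vr'.
  rewrite -[leLHS](poweRVK gamma_lt1 (V_ge0 _)).
  by apply: lee_poweR => //; rewrite ?invr_ge0 ?(ltW gamma_lt1)// poweR_ge0.
move=> K s F st s0 ns mF F0 FV.
have [f [nu [mf f0 nu0 Hf fv]]] := Htest K s st s0 ns.
suff : nu%:E * Nw F <= nu%:E * lambda%:E by rewrite lee_pmul2l.
rewrite -(weighted_normZ N_BFS w_weight (ltW nu0) mF F0) -EFinM.
apply: le_trans fv; apply: le_trans (hardy mf f0).
apply: (weighted_norm_le N_BFS w_weight); [exact: measurable_funeM|exact: mH|].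
move=> x; rewrite mule_ge0 ?lee_fin ?(ltW nu0)//=.
have [->|[j [jK xj ->]]] := FV x; first by rewrite mule0 integral_ge0.
have /andP[Vj0 Vjoo] := V_fin (s0 j jK).
have Vjfin : V (s j) \is a fin_num by rewrite ge0_fin_numE.
rewrite -(fineK Vjfin) poweR_EFin -EFinM (le_trans (Hf j jK))//.
by rewrite integral_outer_le// ltW.
Qed.

End hardy_lower.

(** * Test functions for [p = 1] *)

Section hardy_test_function1.
Context d (T : measurableType d) (R : realType).
Variables (mu : {sigma_finite_measure set T -> \bar R}) (v : T -> \bar R).
Variables (rho : T -> R) (gamma theta : R).
Hypotheses (v_weight : is_weight mu v) (mu_gt0 : 0 < mu setT).
Hypotheses (mrho : measurable_fun setT rho) (gamma01 : (0 < gamma < 1)%R).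
Hypothesis theta01 : (0 < theta < 1)%R.
Local Notation V r := (tail_norm mu 1 v [set y | (r < rho y)%R]).
Hypothesis V_fin : forall r, (0 < r)%R -> 0 < V r < +oo.

(** Normalized functions of cost at most [1 / (theta W k)] are combined with the increments of
    [W ^ (1 - gamma)] as coefficients. The factor [theta < 1] is there because the essential
    supremum need not be attained on a set of positive measure. *)
Lemma hardy_test_function1 (s : nat -> R) K : (forall i, (i <= K)%N -> (0 < s i)%R) ->
  {homo s : i j / (i <= j)%N >-> (j <= i)%R} ->
  exists f : T -> \bar R, [/\ measurable_fun setT f, forall y, 0 <= f y,
    forall k, (k <= K)%N -> (fine (V (s k)) `^ (1 - gamma))%R%:E <=
      \int[mu]_(y in [set y | (s k < rho y)%R]) f y &
    \int[mu]_y (f y * v y) <=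
      (theta^-1 * (fine (V (s 0%N)) `^ (- gamma) / gamma))%R%:E].
Proof.
move=> s0 ns; have [mv v0 _] := v_weight.
have /andP[gamma_gt0 gamma_lt1] := gamma01.
have /andP[theta0 theta1] := theta01.
have V_num k : (k <= K)%N -> V (s k) \is a fin_num.
  by move=> kK; have /andP[? ?] := V_fin (s0 k kK); rewrite ge0_fin_numE// ltW.
have [W WE] : exists W : nat -> R, forall k, W k = fine (V (s k)).
  by exists (fun k => fine (V (s k))).
have W0 k : (k <= K)%N -> (0 < W k)%R.
  by move=> kK; rewrite WE fine_gt0// V_fin// s0.
have mO k : measurable [set y | (s k < rho y)%R] by exact: measurable_outer.
have ext k : (k <= K)%N -> exists f : T -> \bar R, [/\ measurable_fun setT f,
    forall y, 0 <= f y, \int[mu]_(y in [set y | (s k < rho y)%R]) f y = 1 &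
    \int[mu]_y (f y * v y) <= ((theta * W k)^-1)%R%:E].
  move=> kK; apply: tail_norm1_extremal => //; first by rewrite mulr_gt0// W0.
  by rewrite -(fineK (V_num k kK)) -WE lte_fin gtr_pMl// W0.
(* The cost is stated in telescoping form, its increments being those of [powR_slope_le]; dropping
   the term in [W K] gives the claim. *)
suff : forall i, (i <= K)%N -> exists f : T -> \bar R,
    [/\ measurable_fun setT f, forall y, 0 <= f y,
    forall k, (k <= i)%N -> (W k `^ (1 - gamma))%R%:E <=
      \int[mu]_(y in [set y | (s k < rho y)%R]) f y &
    \int[mu]_y (f y * v y) <= (theta^-1 * (W 0%N `^ (- gamma) +
      (1 - gamma) / gamma * (W 0%N `^ (- gamma) - W i `^ (- gamma))))%R%:E].
  move=> /(_ K (leqnn K)) [f [mf f0 Hf fv]]; exists f; split => //.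
    by move=> k kK; rewrite -WE Hf.
  apply: le_trans fv _; rewrite lee_fin ler_pM2l ?invr_gt0// -WE.
  have H : (0 <= (1 - gamma) / gamma * W K `^ (- gamma))%R.
    by rewrite mulr_ge0 ?powR_ge0// divr_ge0 ?subr_ge0// ltW.
  have -> : (W 0%N `^ (- gamma) / gamma =
    W 0%N `^ (- gamma) + (1 - gamma) / gamma * W 0%N `^ (- gamma))%R.
    by field; rewrite gt_eqF.
  lra.
have mfv (f : T -> \bar R) : measurable_fun setT f ->
  measurable_fun setT (fun y => f y * v y) by move=> mf; exact: emeasurable_funM.
elim => [_|i IH iK].
  have [f [mf f0 f1 fv]] := ext 0%N (leq0n K).
  exists (fun y => (W 0%N `^ (1 - gamma))%R%:E * f y); split.
  - exact: measurable_funeM.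
  - by move=> y; rewrite mule_ge0 ?lee_fin ?powR_ge0.
  - move=> k; rewrite leqn0 => /eqP ->.
    by rewrite ge0_integralZl ?f1 ?mule1 ?lee_fin ?powR_ge0//; exact: measurable_funTS.
  - under eq_integral do rewrite -muleA.
    rewrite ge0_integralZl ?lee_fin ?powR_ge0//;
      [|exact: mfv|by move=> y _; rewrite mule_ge0// ltW].
    apply: (@le_trans _ _ ((W 0%N `^ (1 - gamma))%R%:E * ((theta * W 0%N)^-1)%R%:E)).
      by apply: lee_wpmul2l => //; rewrite lee_fin powR_ge0.
    have W00 := W0 0%N (leq0n K).
    rewrite -EFinM lee_fin subrr mulr0 addr0 invfM mulrCA ler_pM2l ?invr_gt0//.
    rewrite powRD ?(gt_eqF W00) ?implybT// powRr1 ?(ltW W00)//.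
    by rewrite mulrAC mulfV ?gt_eqF// mul1r.
have [f [mf f0 Hf fv]] := IH (ltnW iK).
have [h [mh h0 h1 hv]] := ext i.+1 iK.
have ss : (s i.+1 <= s i)%R by exact: ns.
have WW : (W i <= W i.+1)%R.
  rewrite !WE fine_le ?V_num// ?(ltnW iK)//.
  exact: tail_norm_outer_le.
have Wi := W0 i (ltnW iK).
pose c := (W i.+1 `^ (1 - gamma) - W i `^ (1 - gamma))%R.
have c0 : (0 <= c)%R.
  rewrite subr_ge0; apply: ge0_ler_powR WW; rewrite ?nnegrE ?subr_ge0;
    rewrite ?(ltW gamma_lt1) ?(ltW Wi)//.
  exact: ltW (W0 _ iK).
have ch0 y : 0 <= c%:E * h y by rewrite mule_ge0 ?lee_fin.
have mch : measurable_fun setT (fun y => c%:E * h y) by exact: measurable_funeM.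
exists (fun y => f y + c%:E * h y); split.
- exact: emeasurable_funD.
- by move=> y; rewrite adde_ge0.
- move=> k; rewrite leq_eqVlt => /predU1P[->|ki]; last first.
    apply: le_trans (Hf k ki) _; apply: ge0_le_integral => //.
    + exact: measurable_funTS.
    + by apply: measurable_funTS; exact: emeasurable_funD.
    + by move=> y _; rewrite leeDl.
  rewrite ge0_integralD//; try exact: measurable_funTS.
  rewrite ge0_integralZl ?lee_fin//; last exact: measurable_funTS.
  rewrite h1 mule1 -(subrK (W i `^ (1 - gamma))%R (W i.+1 `^ _)%R) -/c EFinD addeC.
  apply: leeD => //; apply: le_trans (Hf i (leqnn i)) _.
  exact: integral_outer_le.
- rewrite (eq_integral (fun y => f y * v y + c%:E * (h y * v y))); last first.
    by move=> y _; rewrite ge0_muleDl// muleA.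
  have hv0 y : 0 <= h y * v y by rewrite mule_ge0// ltW.
  rewrite ge0_integralD//; [|by move=> y _; rewrite mule_ge0// ltW|exact: mfv
    |by move=> y _; rewrite mule_ge0 ?lee_fin|by apply: measurable_funeM; exact: mfv].
  rewrite ge0_integralZl ?lee_fin//; last exact: mfv.
  apply: le_trans (leeD fv (lee_wpmul2l _ hv)) _; first by rewrite lee_fin.
  rewrite -EFinM -EFinD lee_fin invfM mulrCA -mulrDr ler_pM2l ?invr_gt0//.
  have P := powR_slope_le gamma01 Wi WW.
  have {}P : (c / W i.+1 <=
      (1 - gamma) / gamma * (W i `^ (- gamma) - W i.+1 `^ (- gamma)))%R.
    rewrite -(ler_pM2l gamma_gt0) [leRHS](_ : _ =
      (1 - gamma) * (W i `^ (- gamma) - W i.+1 `^ (- gamma)))%R//.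
    by field; rewrite gt_eqF.
  by lra.
Qed.

End hardy_test_function1.

Section hardy_lower_bound.
Context d (T : measurableType d) (R : realType).
Variables (mu : {sigma_finite_measure set T -> \bar R}) (N : (T -> R) -> \bar R).
Variables (p C gamma : R) (v w : T -> \bar R) (rho : T -> R).
Hypotheses (p_ge1 : (1 <= p)%R) (gamma01 : (0 < gamma < 1)%R).
Hypotheses (v_weight : is_weight mu v) (w_weight : is_weight mu w).
Hypotheses (N_BFS : is_BFS mu N) (C_gt0 : (0 < C)%R).
Hypotheses (mrho : measurable_fun setT rho) (rho_ge0 : forall x, (0 <= rho x)%R).
Hypothesis outer_gt0 : forall r, (0 < r)%R -> 0 < mu [set y | (r < rho y)%R].
Hypothesis inner_gt0 : forall r, (0 < r)%R -> 0 < mu [set y | (rho y < r)%R].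
Hypothesis hardy : forall f : T -> \bar R,
  measurable_fun setT f -> (forall y, 0 <= f y) ->
  weighted_norm mu N w (fun x => \int[mu]_(y in [set y | (rho x < rho y)%R]) f y) <=
  C%:E * (\int[mu]_y (f y * v y) `^ p) `^ p^-1.

Local Notation V r := (tail_norm mu p v [set y | (r < rho y)%R]).

(** [hardy_profile_le] is applied to the test functions of the two cases, with [lambda] chosen so
    that the product is exactly [C] for [p > 1], and [C / theta] for [p = 1]. *)
Lemma hardy_lower (t : R) : (0 < t)%R ->
  (lower_factor gamma p)%:E *
  (V t `^ gamma * weighted_norm mu N w (hardy_profile mu p gamma v rho t)) <= C%:E.
Proof.
move=> t0.
have /andP[gamma_gt0 gamma_lt1] := gamma01.
have muT_gt0 : 0 < mu setT.
  apply: lt_le_trans (outer_gt0 ltr01) _.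
  by apply: le_measure; rewrite ?inE//; exact: measurable_outer.
have V_fin r : (0 < r)%R -> 0 < V r < +oo.
  move=> r0; rewrite (hardy_tail_finite p_ge1 v_weight w_weight N_BFS C_gt0 mrho
    outer_gt0 inner_gt0 hardy r0) andbT.
  apply: tail_norm_gt0 => //; first exact: measurable_outer.
  exact: outer_gt0.
have /andP[V0 Voo] := V_fin t t0.
have Vf : V t \is a fin_num by rewrite ge0_fin_numE// ltW.
have v0 : (0 < fine (V t))%R by rewrite fine_gt0// V0.
have lf0 : (0 < lower_factor gamma p)%R by exact: lower_factor_gt0.
have final (lambda eta : R) : (0 <= lambda)%R ->
    weighted_norm mu N w (hardy_profile mu p gamma v rho t) <= lambda%:E ->
    (lower_factor gamma p * fine (V t) `^ gamma * lambda <= eta)%R ->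
    (lower_factor gamma p)%:E *
    (V t `^ gamma * weighted_norm mu N w (hardy_profile mu p gamma v rho t)) <= eta%:E.
  move=> l0 Nl le_eta; apply: (@le_trans _ _
      ((lower_factor gamma p)%:E * ((fine (V t) `^ gamma)%R%:E * lambda%:E))).
    apply: lee_wpmul2l; first by rewrite lee_fin ltW.
    rewrite -{1}(fineK Vf) poweR_EFin; apply: lee_wpmul2l => //.
    by rewrite lee_fin powR_ge0.
  by rewrite -!EFinM lee_fin mulrA.
have profile_le := hardy_profile_le p_ge1 v_weight w_weight N_BFS C_gt0 mrho rho_ge0
  outer_gt0 inner_gt0 hardy gamma01 t0.
move: (p_ge1); rewrite le_eqVlt => /predU1P[p1|p1].
  have H (theta : R) : (0 < theta < 1)%R ->
      (lower_factor gamma p)%:E *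
      (V t `^ gamma * weighted_norm mu N w (hardy_profile mu p gamma v rho t)) <=
      (C / theta)%R%:E.
    move=> theta01; have /andP[theta0 theta1] := theta01.
    pose lambda := (C * (theta^-1 * (fine (V t) `^ (- gamma) / gamma)))%R.
    have l0 : (0 <= lambda)%R.
      rewrite mulr_ge0 ?mulr_ge0 ?powR_ge0 ?invr_ge0 ?(ltW C_gt0)//.
        exact: ltW.
      exact: ltW.
    apply: (final lambda _ l0); last first.
      rewrite -p1 lower_factor1// p1 /lambda powRN.
      rewrite le_eqVlt; apply/orP; left; apply/eqP.
      by field; rewrite !gt_eqF// powR_gt0.
    apply: profile_le => K s st s0 ns.
    have V_fin1 r : (0 < r)%R -> 0 < tail_norm mu 1 v [set y | (r < rho y)%R] < +oo.
      by rewrite p1; exact: V_fin.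
    have [f [mf f0 Hf fv]] := hardy_test_function1 v_weight muT_gt0 mrho gamma01 theta01
      V_fin1 s0 ns.
    exists f, 1%R; split => //.
      by move=> k kK; rewrite mul1r -p1; exact: Hf.
    rewrite mul1r /lambda -p1 invr1 poweRe1; last first.
      by apply: integral_ge0 => y _; exact: poweR_ge0.
    have [_ vy0 _] := v_weight.
    under eq_integral do rewrite poweRe1 ?mule_ge0// ?ltW//.
    by rewrite EFinM; apply: lee_wpmul2l; [rewrite lee_fin ltW|rewrite -st].
  apply/lee_addgt0Pr => e e0.
  (* This value of [theta] makes [C / theta] equal to [C + e]. *)
  have th01 : (0 < C / (C + e) < 1)%R.
    by rewrite divr_gt0 ?addr_gt0//= ltr_pdivrMr ?addr_gt0// mul1r ltrDl.
  apply: le_trans (H _ th01) _; rewrite -EFinD lee_fin invf_div.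
  by rewrite mulrCA mulfV ?mulr1// gt_eqF.
set q := (p / (p - 1))%R; have p0 : (0 < p)%R by exact: lt_trans p1.
have q0 : (0 < q)%R by rewrite divr_gt0 ?subr_gt0.
set kappa := (q / (1 - gamma))%R.
have kappa0 : (0 < kappa)%R by rewrite divr_gt0 ?subr_gt0.
pose D := (kappa `^ p + (gamma * (p - 1))^-1)%R.
have D0 : (0 < D)%R.
  by rewrite addr_gt0 ?powR_gt0// invr_gt0 mulr_gt0// subr_gt0.
pose lambda := (C * (fine (V t) `^ (- gamma) * D `^ p^-1) / kappa)%R.
have l0 : (0 <= lambda)%R.
  by rewrite divr_ge0 ?(ltW kappa0)// mulr_ge0 ?mulr_ge0 ?powR_ge0 ?(ltW C_gt0).
apply: (final lambda _ l0); last first.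
  rewrite lower_factorE// -/q -/kappa -/D /lambda powRN.
  rewrite le_eqVlt; apply/orP; left; apply/eqP.
  by field; rewrite !gt_eqF ?powR_gt0.
apply: profile_le => K s st s0 ns.
have [f [mf f0 Hf fv]] := hardy_test_function v_weight muT_gt0 p1 gamma01 mrho
  V_fin s0 ns.
exists f, kappa; split => //.
have -> : (kappa * lambda = C * ((fine (V t) `^ (- (gamma * p)) * D) `^ p^-1))%R.
  rewrite powRM ?powR_ge0 ?(ltW D0)// -powRrM mulNr mulfK ?gt_eqF// /lambda.
  by field; rewrite gt_eqF.
rewrite EFinM; apply: lee_wpmul2l; first by rewrite lee_fin ltW.
rewrite -poweR_EFin -st; apply: lee_poweR => //; first by rewrite invr_ge0 ltW.
by apply: integral_ge0 => y _; exact: poweR_ge0.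
Qed.

End hardy_lower_bound.

(** * Euclidean space *)

Section euclidean_norm.
Context {R : realType} {n : nat}.

Lemma enorm_ge0 (x : Rn R n) : (0 <= enorm x)%R.
Proof. exact: sqrtr_ge0. Qed.

Lemma measurable_enorm : measurable_fun setT (@enorm R n).
Proof.
(* Measurability is proved for the Borel structure on tuples and transferred to Lebesgue measurable
   sets. *)
suff me : measurable_fun setT
    (fun x : n.-tuple (measurableTypeR R) => Num.sqrt (\sum_(i < n) (tnth x i) ^+ 2)%R).
  move=> _ Y mY; rewrite setTI.
  by have [+ _] := lebesgue_Rn_borel (me measurableT Y mY); rewrite setTI.
apply: (measurableT_comp (f := @Num.sqrt R)).
  apply: continuous_measurable_fun; exact: sqrt_continuous.
apply: measurable_sum => i; apply: measurable_funX; exact: measurable_tnth.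
Qed.

Lemma lebesgue_Rn_box_gt0 (A : set (Rn R n)) (a b : 'I_n -> R) : measurable A ->
  (forall i, (a i < b i)%R) ->
  (forall x : Rn R n, (forall i, (a i < tnth x i < b i)%R) -> A x) ->
  0 < lebesgue_Rn A.
Proof.
move=> mA ab boxA.
pose I i : set (measurableTypeR R) := `]a i, b i[%classic.
pose box := [set x : n.-tuple (measurableTypeR R) | forall i, I i (tnth x i)].
have mbox : measurable box.
  rewrite (_ : box = \bigcap_(i in [set: 'I_n]) (fun x => tnth x i) @^-1` I i).
    apply: fin_bigcap_measurable => // i _; rewrite -[X in measurable X]setTI.
    by apply: measurable_tnth => //; exact: measurable_itv.
  by apply/seteqP; split => x /= => [Ix i _|Ix i]; [exact: Ix|exact: (Ix i)].
have [mbox' box'E] := lebesgue_Rn_borel mbox.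
apply: (@lt_le_trans _ _ (lebesgue_Rn (box : set (Rn R n)))); last first.
  have boxS : (box : set (Rn R n)) `<=` A.
    by move=> x Ix; apply: boxA => i; have := Ix i; rewrite /I /= in_itv.
  by apply: le_measure boxS; rewrite inE.
rewrite box'E leb_borel_box; last by move=> i; exact: measurable_itv.
apply: (big_ind (fun x : \bar R => 0 < x)) => // [x y|i _]; first exact: mule_gt0.
by rewrite lebesgue_measure_itv/= lte_fin ab -EFinD lte_fin subr_gt0.
Qed.

(** The box with all coordinates between [r] and [r + 1] lies in the exterior as soon as there is a
    coordinate; in dimension 0 the exterior is empty. *)
Lemma outer_ball_gt0 (r : R) : (0 < n)%N -> (0 < r)%R ->
  0 < lebesgue_Rn [set y : Rn R n | (r < enorm y)%R].
Proof.
move=> n0 r0.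
apply: (@lebesgue_Rn_box_gt0 _ (fun=> r) (fun=> r + 1)%R).
- exact: (measurable_outer measurable_enorm).
- by move=> i; rewrite ltrDl.
- move=> x Ix /=; pose i0 := Ordinal n0; have /andP[rx _] := Ix i0.
  apply: (lt_le_trans rx); apply: (le_trans (ler_norm _)).
  rewrite -sqrtr_sqr ler_sqrt ?sumr_ge0// => [|i _]; last exact: sqr_ge0.
  by rewrite (bigD1 i0)//= lerDl sumr_ge0// => i _; exact: sqr_ge0.
Qed.

Lemma inner_ball_gt0 (r : R) : (0 < r)%R ->
  0 < lebesgue_Rn [set y : Rn R n | (enorm y < r)%R].
Proof.
(* Dividing by [n + 1] keeps the sum of squares, at most [n e ^ 2], strictly below [r ^ 2],
   including for [n = 0]. *)
move=> r0; pose e := (r / n.+1%:R)%R.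
have e0 : (0 < e)%R by rewrite divr_gt0.
apply: (@lebesgue_Rn_box_gt0 _ (fun=> 0%R) (fun=> e)).
- exact: (measurable_inner measurable_enorm).
- by move=> i.
- move=> x Ix /=.
  rewrite -[ltRHS]gtr0_norm// -sqrtr_sqr ltr_sqrt ?exprn_gt0//.
  apply: (@le_lt_trans _ _ (\sum_(i < n) e ^+ 2)%R).
    apply: ler_sum => i _; have /andP[x0 xe] := Ix i.
    by rewrite ler_sqr ?nnegrE ?ltW.
  rewrite sumr_const card_ord -mulr_natl.
  apply: (@lt_le_trans _ _ (n.+1%:R * e ^+ 2)%R).
    by rewrite ltr_pM2r ?exprn_gt0// ltr_nat.
  have rE : r = (n.+1%:R * e)%R by rewrite /e mulrC divfK.
  have -> : (r ^+ 2 = n.+1%:R ^+ 2 * e ^+ 2)%R by rewrite -exprMn -rE.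
  rewrite ler_pM2r ?exprn_gt0// expr2 ler_peMl// ler1n//.
Qed.

End euclidean_norm.

Lemma Lnorm_ge0E d (T : measurableType d) (R : realType)
    (mu : {measure set T -> \bar R}) (p : R) (f : T -> \bar R) :
  (forall x, 0 <= f x) -> Lnorm mu p%:E f = (\int[mu]_x f x `^ p) `^ p^-1.
Proof.
by move=> f0; rewrite unlock; under eq_integral do rewrite gee0_abs//.
Qed.

Section hardy_Rn.
Context {R : realType} {n : nat}.
Variables (p M : R) (v w : Rn R n -> \bar R) (N : (Rn R n -> R) -> \bar R).
Hypotheses (n_gt0 : (0 < n)%N) (p_ge1 : (1 <= p)%R).
Hypotheses (v_weight : is_weight lebesgue_Rn v) (w_weight : is_weight lebesgue_Rn w).
Hypotheses (N_BFS : is_BFS lebesgue_Rn N).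
Hypotheses (M_gt0 : (0 < M)%R) (w_convex : p_convex lebesgue_Rn N w p M).

Let v_gt0 y : 0 < v y. Proof. by have [] := v_weight. Qed.

Let p_gt0 : (0 < p)%R. Proof. exact: lt_le_trans p_ge1. Qed.

Lemma hardy_B_ge (gamma t : R) : (0 < t)%R ->
  dual_tail p v t `^ gamma *
  weighted_norm lebesgue_Rn N w (hardy_profile lebesgue_Rn p gamma v enorm t) <=
  hardy_B p v w N gamma.
Proof. by move=> t0; apply: ereal_sup_ubound; exists t. Qed.

Lemma hardy_B_ge0 (gamma : R) : (0 < gamma < 1)%R -> 0 <= hardy_B p v w N gamma.
Proof.
move=> gamma01; apply: le_trans (hardy_B_ge gamma ltr01).
apply: mule_ge0; first exact: poweR_ge0.
apply: (weighted_norm_ge0 N_BFS w_weight).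
apply: (measurable_hardy_profile p_ge1 gamma01 v_weight measurable_enorm).
by move=> r; exact: outer_ball_gt0.
Qed.

Lemma hardy_inequality_B_le (gamma C : R) : (0 < gamma < 1)%R -> (0 < C)%R ->
  hardy_inequality p v w N C ->
  (lower_factor gamma p)%:E * hardy_B p v w N gamma <= C%:E.
Proof.
move=> gamma01 C0 HC; have lf0 := lower_factor_gt0 gamma01 p_ge1.
rewrite muleC -lee_pdivlMr//; apply: ge_ereal_sup => _ [t t0 <-].
rewrite lee_pdivlMr// muleC.
apply: (hardy_lower p_ge1 gamma01 v_weight w_weight N_BFS C0 measurable_enorm
  enorm_ge0 _ inner_ball_gt0 _ t0).
  by move=> r; exact: outer_ball_gt0.
move=> f mf f0; have := HC f mf f0; rewrite Lnorm_ge0E//.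
by move=> y; rewrite mule_ge0// ltW.
Qed.

Lemma hardy_inequality_of_B (gamma C : R) : (0 < gamma < 1)%R -> (0 < C)%R ->
  M%:E * ((upper_factor gamma p)%:E * hardy_B p v w N gamma) <= C%:E ->
  hardy_inequality p v w N C.
Proof.
move=> gamma01 C0 BC f mf f0.
have uf0 := upper_factor_gt0 gamma01 p_ge1.
have B0 := hardy_B_ge0 gamma01.
have Bfin : hardy_B p v w N gamma \is a fin_num.
  rewrite ge0_fin_numE// ltey; apply/eqP => Boo; move: BC; rewrite Boo.
  by rewrite gt0_muley// gt0_muley.
have fv0 y : 0 <= f y * v y by rewrite mule_ge0// ltW.
rewrite Lnorm_ge0E//.
(* If the norm of [f] is infinite, the right-hand side is [+oo] because [0 < C]. *)
have [->|Ioo] := eqVneq (\int[lebesgue_Rn]_x (f x * v x) `^ p) +oo.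
  by rewrite eqy_poweR ?invr_gt0// gt0_muley// leey.
have H := hardy_upper p_ge1 gamma01 v_weight w_weight N_BFS M_gt0 w_convex
  measurable_enorm enorm_ge0 (fun r => @outer_ball_gt0 R n r n_gt0) inner_ball_gt0.
have {}H := H (fine (hardy_B p v w N gamma)) (fine_ge0 B0) _ f mf f0.
apply: le_trans (H _ _) _.
- by move=> r r0; rewrite fineK//; exact: hardy_B_ge.
- by rewrite ltey.
- apply: lee_wpmul2r; first exact: poweR_ge0.
  by rewrite -mulrA EFinM EFinM fineK.
Qed.

End hardy_Rn.

Theorem theorem3 (R : realType) (n : nat) (p M : R)
    (v w : Rn R n -> \bar R) (N : (Rn R n -> R) -> \bar R)
    (n_gt0 : (0 < n)%N) (p_ge1 : (1 <= p)%R)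
    (v_weight : is_weight lebesgue_Rn v) (w_weight : is_weight lebesgue_Rn w)
    (N_BFS : is_BFS lebesgue_Rn N)
    (M_gt0 : (0 < M)%R) (w_convex : p_convex lebesgue_Rn N w p M) :
  (forall gamma : R, (0 < gamma < 1)%R ->
     (exists2 C : R, (0 < C)%R & hardy_inequality p v w N C) <->
     hardy_B p v w N gamma < +oo) /\
  (forall C : R, (0 < C)%R -> best_constant p v w N C ->
     ereal_sup [set (lower_factor gamma p)%:E * hardy_B p v w N gamma
               | gamma in [set gamma : R | (0 < gamma < 1)%R]] <= C%:E /\
     C%:E <= M%:E *
       ereal_inf [set (upper_factor gamma p)%:E * hardy_B p v w N gamma
                 | gamma in [set gamma : R | (0 < gamma < 1)%R]]).
Proof.
have B_le := hardy_inequality_B_le n_gt0 p_ge1 v_weight w_weight N_BFS.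
have of_B := hardy_inequality_of_B n_gt0 p_ge1 v_weight w_weight N_BFS M_gt0 w_convex.
have B0 := hardy_B_ge0 n_gt0 p_ge1 v_weight w_weight N_BFS.
split => [gamma gamma01|C C0 [HC C_best]].
  have lf0 := lower_factor_gt0 gamma01 p_ge1.
  have uf0 := upper_factor_gt0 gamma01 p_ge1.
  split => [[C C0 HC]|Boo].
    rewrite ltey; apply/eqP => Boo; have := B_le _ _ gamma01 C0 HC.
    by rewrite Boo gt0_muley.
  have Bfin : hardy_B p v w N gamma \is a fin_num by rewrite ge0_fin_numE// B0.
  have b0 : (0 <= fine (hardy_B p v w N gamma))%R by rewrite fine_ge0// B0.
  (* The summand 1 ensures a positive constant when [B(gamma)] is only known to be nonnegative. *)
  have C0 : (0 < M * (upper_factor gamma p * fine (hardy_B p v w N gamma)) + 1)%R.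
    by rewrite ltr_wpDl// !mulr_ge0// ltW.
  exists (M * (upper_factor gamma p * fine (hardy_B p v w N gamma)) + 1)%R => //.
  apply: (of_B _ _ gamma01 C0).
  by rewrite -(fineK Bfin) -!EFinM lee_fin lerDl.
split.
  by apply: ge_ereal_sup => _ [gamma gamma01 <-]; exact: B_le.
(* Dividing by [M] allows the infimum to be tested one [gamma] at a time. *)
rewrite muleC -lee_pdivrMr//; apply: le_ereal_inf_tmp => _ [gamma gamma01 <-].
rewrite lee_pdivrMr// muleC.
have uf0 := upper_factor_gt0 gamma01 p_ge1.
have [->|Boo] := eqVneq (hardy_B p v w N gamma) +oo.
  by rewrite gt0_muley// gt0_muley// leey.
have Bfin : hardy_B p v w N gamma \is a fin_num by rewrite ge0_fin_numE ?B0// ltey.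
(* Optimality compares [C] with positive constants only; the arbitrary [e > 0] secures
   positivity. *)
apply/lee_addgt0Pr => e e0.
have b0 : (0 <= fine (hardy_B p v w N gamma))%R by rewrite fine_ge0// B0.
rewrite -(fineK Bfin) -!EFinM -EFinD lee_fin.
have C'0 : (0 < M * (upper_factor gamma p * fine (hardy_B p v w N gamma)) + e)%R.
  by rewrite ltr_wpDl// !mulr_ge0// ltW.
apply: C_best => //; apply: (of_B _ _ gamma01 C'0).
by rewrite -(fineK Bfin) -!EFinM lee_fin lerDl ltW.
Qed.
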